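(* There is an absolute constant $C>0$ and, for every $n\ge 2$ and $\delta\in(0,1/2]$, an algorithm $\mathcal{A}_{n,\delta}$ for the $n$-armed bandit model such that the following holds. For every instance whose arms, after relabeling, satisfy $\theta_1>\theta_2\ge\cdots\ge\theta_n$ (the labeling/ordering being unknown to the algorithm), with probability at least $1-\delta$ the algorithm $\mathcal{A}_{n,\delta}$ outputs the best arm (the arm with mean $\theta_1$) and uses at most $$C\sum_{i=1}^n\Big(\frac{\sigma_i^2}{\Delta_i^2}+\frac{1}{\Delta_i}\Big)\big(\ln\delta^{-1}+\mathrm{LL}(\Delta_i^{-1})\big)$$ samples.
   Context: Bandit model: there are $n\ge2$ arms; each time arm $i$ is sampled (pulled), one observes an independent draw from an unknown distribution $\mathcal{D}_i$ supported on $[0,1]$ with mean $\theta_i$ and variance $\sigma_i^2$. An algorithm adaptively chooses (possibly using internal randomness) which arm to sample next based on all past observations, and eventually stops and outputs an arm; its sample complexity is the total number of samples taken. For an instance with $\theta_1>\theta_2\ge\cdots\ge\theta_n$ we write $\Delta_i=\theta_1-\theta_i$ for $i\ge2$ and $\Delta_1=\Delta_2$. For $x\ge1$, $\mathrm{LL}(x):=\ln(e+\ln x)$. *)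

(* Defs.v *)
From HB Require Import structures.
From mathcomp Require Import all_boot all_order all_algebra.
From mathcomp Require Import all_classical all_reals all_analysis.
Set Implicit Arguments. Unset Strict Implicit. Unset Printing Implicit Defensive.
Import Order.TTheory GRing.Theory Num.Theory.
Local Open Scope classical_set_scope.
Local Open Scope ring_scope.

Inductive action (n : nat) : Type := Pull of 'I_n | Stop of 'I_n.
Arguments Pull {n}. Arguments Stop {n}.

(* A (possibly randomized) adaptive algorithm for the n-armed bandit model:
   at step t it sees the internal random seeds u_0, ..., u_t (i.i.d. uniform
   on [0,1]) and the full history of (arm sampled, observed value) pairs,
   and decides the next action. *)
Definition algorithm (R : realType) (n : nat) :=
  seq R -> seq ('I_n * R) -> action n.

(* Execution in the "reward table" model: obs i k is the value returned by the
   (k+1)-th sample of arm i; seeds t is the t-th internal random seed.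
   run t = (history after t steps, Some a if the algorithm has stopped with
   output a).  Once stopped, the state is frozen. *)
Fixpoint run (R : realType) (n : nat) (alg : algorithm R n)
    (obs : 'I_n -> nat -> R) (seeds : nat -> R) (t : nat)
    : seq ('I_n * R) * option 'I_n :=
  match t with
  | 0 => ([::], None)
  | t'.+1 =>
      let st := run alg obs seeds t' in
      match st.2 with
      | Some a => st
      | None =>
          match alg (mkseq seeds t'.+1) st.1 with
          | Pull i => (rcons st.1 (i, obs i (count (fun p => p.1 == i) st.1)),
                       None)
          | Stop a => (st.1, Some a)
          end
      end
  end.

Definition outputs_within (R : realType) (n : nat) (alg : algorithm R n)
    (obs : 'I_n -> nat -> R) (seeds : nat -> R) (b : 'I_n) (N : R) : Prop :=
  exists t, (run alg obs seeds t).2 = Some b /\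
            ((size (run alg obs seeds t).1)%:R <= N).

Definition mutually_independent d (T : measurableType d) (R : realType)
    (P : probability T R) (I : eqType) (Y : I -> T -> R) : Prop :=
  forall (J : seq I) (B : I -> set R), uniq J ->
    (forall i, i \in J -> measurable (B i)) ->
    P (\big[setI/setT]_(i <- J) (Y i @^-1` B i)) =
    (\prod_(i <- J) P (Y i @^-1` B i))%E.

Definition dmean (R : realType) (D : probability R R) : R := fine ('E_D[id])%E.
Definition dvar (R : realType) (D : probability R R) : R := fine ('V_D[id])%E.

Definition LL (R : realType) (x : R) : R := ln (expR 1 + ln x).

Definition gap (R : realType) (n : nat) (theta : 'I_n -> R) (b i : 'I_n) : R :=
  if i == b then theta b - \big[Num.max/0]_(j | j != b) theta j
  else theta b - theta i.

(* Main.v *)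
(* Round r works at accuracy eps = (2/3)^r / 6. It keeps a set S of arms and an interval
   of length 6 eps containing the best mean. For each arm of S it estimates the weight
   sigma^2 / eps^2 + 1 / eps, which by Bernstein's inequality is the price of an
   estimate of its mean. Whether some arm exceeds a threshold is decided by repeated
   sampling with growing confidence: arms below the threshold lose most of their total
   weight at each pass, so the answer is yes as soon as half of the weight is retained,
   and the cost is geometric, with no ln n factor. One such test shrinks the interval,
   the arms of S below it are discarded, and a second test on S without its heaviest arm
   a stops the algorithm with output a if it answers no.

   Arm i is paid for up to the scale where 6 eps <= Delta_i. From then on it survives a
   round with probability O(q), where q = delta / (C (r+2)^2), which beats the growth of
   the weights. The best arm overshoots its scale only if a test fails or if another
   surviving arm is estimated to be at least as heavy, and is then charged to that arm.
   The expected excess is thus O(delta) times the budget, and Markov's inequality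
   concludes. *)
Require Import Defs.
From HB Require Import structures.
From mathcomp Require Import all_boot all_order all_algebra.
From mathcomp Require Import all_classical all_reals all_analysis.
From mathcomp Require Import measurable_realfun ring lra zify.
Set Implicit Arguments. Unset Strict Implicit. Unset Printing Implicit Defensive.
Import Order.TTheory GRing.Theory Num.Theory.
Local Open Scope classical_set_scope.
Local Open Scope ring_scope.

(** * Sampling programs *)

(** The target contains no [ln n], so a union bound over the arms is excluded. Only events about the
    best arm [b] are asked to hold in every round; the other arms may be misjudged and are
    controlled on average, through quantities that are linear in the surviving set: retained weight,
    present cost, future cost. This is why the weight estimator has to be unbiased and not merely
    accurate with high probability. No global success event is conditioned on. A failure is given a
    finite price [B], and one induction on the number of rounds bounds [B] times the failure
    probability together with the expected excess of samples; Markov's inequality is folded into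
    that induction. The loop may run forever on unlucky rewards, so it is represented by a family of
    programs with bounded fuel, each refining the previous one. A program that exhausts a large fuel
    has drawn too many samples anyway, so the event of the theorem is decided by a single finite
    program, whose law is an iterated finite sum. *)

(* [Smp i M k] draws a sample of arm [i] and continues with [k j], where [j / M] is
   the reward rounded down to the grid of mesh [1 / M]. Rounding makes every decision
   depend on finitely many values: expectations are finite sums and measurability
   is automatic. *)
Inductive prog (n : nat) (A : Type) : Type :=
| Ret of A
| Smp of 'I_n & nat & (nat -> prog n A).
Arguments Ret {n A}.
Arguments Smp {n A}.

Fixpoint bind n A B (p : prog n A) (k : A -> prog n B) : prog n B :=
  match p with
  | Ret a => k a
  | Smp i M c => Smp i M (fun j => bind (c j) k)
  end.

(* In [outs], as in [Ex] below, [c] counts the samples drawn on the branch. *)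
Fixpoint outs n A (p : prog n A) (Q : A -> nat -> Prop) : Prop :=
  match p with
  | Ret a => Q a 0
  | Smp i M k => forall j, outs (k j) (fun a c => Q a c.+1)
  end.

Section prog_expectation.
Variables (R : realType) (n : nat) (pr : 'I_n -> nat -> nat -> R).

(* [pr i M j] is the probability that a sample of arm [i] falls in cell [j] of the
   grid of mesh [1 / M]. *)
Fixpoint Ex A (p : prog n A) (f : A -> nat -> R) : R :=
  match p with
  | Ret a => f a 0
  | Smp i M k => \sum_(j < M.+1) pr i M j * Ex (k j) (fun a c => f a c.+1)
  end.

Lemma outs_imp A (p : prog n A) (Q Q' : A -> nat -> Prop) :
  (forall a c, Q a c -> Q' a c) -> outs p Q -> outs p Q'.
Proof.
elim: p Q Q' => [a|i M k IH] Q Q' QQ' /=; first exact: QQ'.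
by move=> H j; apply: IH (H j) => a c; exact: QQ'.
Qed.

Lemma outsT A (p : prog n A) (Q : A -> nat -> Prop) :
  (forall a c, Q a c) -> outs p Q.
Proof. by elim: p Q => [a|i M k IH] Q H //= j; apply: IH. Qed.

Lemma outs_and A (p : prog n A) (Q Q' : A -> nat -> Prop) :
  outs p Q -> outs p Q' -> outs p (fun a c => Q a c /\ Q' a c).
Proof.
elim: p Q Q' => [a|i M k IH] Q Q' //= H H' j.
exact: (IH j (fun a c => Q a c.+1) (fun a c => Q' a c.+1)).
Qed.

Lemma outs_bind A B (p : prog n A) (k : A -> prog n B) (Q : B -> nat -> Prop) :
  outs p (fun a c => outs (k a) (fun b c' => Q b (c + c')%N)) ->
  outs (bind p k) Q.
Proof.
elim: p Q => [a|i M c IH] Q /= H.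
  by apply: outs_imp H => b c'.
by move=> j; apply: IH; apply: outs_imp (H j) => a m; apply: outs_imp.
Qed.

Lemma Ex_bind A B (p : prog n A) (k : A -> prog n B) f :
  Ex (bind p k) f = Ex p (fun a c => Ex (k a) (fun b c' => f b (c + c')%N)).
Proof.
elim: p f => [a|i M c IH] f //=.
by apply: eq_bigr => j _; rewrite IH.
Qed.

Lemma eq_Ex A (p : prog n A) f g : (forall a c, f a c = g a c) -> Ex p f = Ex p g.
Proof. by move=> fg; congr Ex; apply/funext => a; apply/funext => c. Qed.

Lemma ExD A (p : prog n A) f g :
  Ex p (fun a c => f a c + g a c) = Ex p f + Ex p g.
Proof.
elim: p f g => [a|i M k IH] f g //=.
rewrite -big_split; apply: eq_bigr => j _ /=.
by rewrite -mulrDr; congr (_ * _); apply: IH.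
Qed.

Lemma ExZ A (p : prog n A) a f :
  Ex p (fun x c => a * f x c) = a * Ex p f.
Proof.
elim: p f => [x|i M k IH] f //=.
rewrite mulr_sumr; apply: eq_bigr => j _ /=.
by rewrite mulrCA; congr (_ * _); apply: IH.
Qed.

Lemma Ex_sum A (p : prog n A) I (s : seq I) f :
  Ex p (fun x c => \sum_(i <- s) f i x c) = \sum_(i <- s) Ex p (f i).
Proof.
elim: s => [|i s IH].
  rewrite big_nil -[RHS](mul0r (Ex p (fun _ _ => 0))) -ExZ.
  by congr (Ex p _); apply/funext => x; apply/funext => c; rewrite big_nil mul0r.
rewrite big_cons -IH -ExD; congr (Ex p _).
by apply/funext => x; apply/funext => c; rewrite big_cons.
Qed.

Hypothesis pr_ge0 : forall i M j, 0 <= pr i M j.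
Hypothesis pr_sum : forall i M, \sum_(j < M.+1) pr i M j = 1.

Lemma Ex_cst A (p : prog n A) x : Ex p (fun _ _ => x) = x.
Proof.
elim: p => [//|i M k IH] /=.
by under eq_bigr => j _ do rewrite IH; rewrite -mulr_suml pr_sum mul1r.
Qed.

(** Links the two semantics: an invariant true on every branch, such as a bound on the number of
    samples, can be used inside an expectation. *)
Lemma le_Ex_outs A (p : prog n A) (Q : A -> nat -> Prop) f g :
  outs p Q -> (forall a c, Q a c -> f a c <= g a c) -> Ex p f <= Ex p g.
Proof.
elim: p Q f g => [a|i M k IH] Q f g /= oQ fg; first exact: fg.
apply: ler_sum => j _; apply: ler_wpM2l => //.
by apply: IH (oQ j) _ => a c; apply: fg.
Qed.

Lemma le_Ex A (p : prog n A) f g :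
  (forall a c, f a c <= g a c) -> Ex p f <= Ex p g.
Proof. by move=> fg; apply: (@le_Ex_outs _ _ (fun _ _ => True)) => //; apply: outsT. Qed.

Lemma Ex_ge0 A (p : prog n A) f : (forall a c, 0 <= f a c) -> 0 <= Ex p f.
Proof. by move=> f0; rewrite -(Ex_cst p 0); apply: le_Ex. Qed.

Lemma Ex_le A (p : prog n A) f x : (forall a c, f a c <= x) -> Ex p f <= x.
Proof. by move=> fx; rewrite -(Ex_cst p x); apply: le_Ex. Qed.

Lemma Ex_bool_le1 A (p : prog n A) (f : A -> nat -> bool) :
  Ex p (fun a c => (f a c)%:R) <= 1.
Proof. by apply: Ex_le => a c; rewrite lern1 leq_b1. Qed.

End prog_expectation.

Fixpoint sum_prog (R : realType) n (m : nat) (d : prog n R) : prog n R :=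
  if m is m'.+1 then bind d (fun x => bind (sum_prog m' d) (fun s => Ret (x + s)))
  else Ret 0.

Section sum_prog.
Variables (R : realType) (n : nat) (pr : 'I_n -> nat -> nat -> R).
Hypothesis pr_ge0 : forall i M j, 0 <= pr i M j.
Hypothesis pr_sum : forall i M, \sum_(j < M.+1) pr i M j = 1.

Lemma Ex_sum_prog (d : prog n R) m :
  Ex pr (sum_prog m d) (fun s _ => s) = m%:R * Ex pr d (fun x _ => x).
Proof.
elim: m => [|m IH] /=; first by rewrite mul0r.
rewrite Ex_bind; under eq_fun do under eq_fun do rewrite Ex_bind /=.
under eq_fun do under eq_fun do rewrite ExD Ex_cst// IH.
by rewrite ExD Ex_cst// -natr1 mulrDl mul1r addrC.
Qed.

Lemma Ex_expR_sum_prog (d : prog n R) m a :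
  Ex pr (sum_prog m d) (fun s _ => expR (a * s)) =
  Ex pr d (fun x _ => expR (a * x)) ^+ m.
Proof.
elim: m => [|m IH] /=; first by rewrite mulr0 expR0 expr0.
rewrite Ex_bind; under eq_fun do under eq_fun do rewrite Ex_bind /=.
under eq_fun do under eq_fun do under eq_fun do under eq_fun do rewrite mulrDr expRD.
under eq_fun do under eq_fun do rewrite ExZ IH mulrC.
by rewrite ExZ exprSr.
Qed.

Lemma outs_sum_prog (d : prog n R) m k :
  outs d (fun _ c => c = k) -> outs (sum_prog m d) (fun _ c => c = (m * k)%N).
Proof.
move=> dk; elim: m => [|m IH] //=.
apply: outs_bind; apply: outs_imp dk => x c ->.
apply: outs_bind; apply: outs_imp IH => s c' -> /=.
by rewrite addn0 mulSn.
Qed.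

End sum_prog.

(** * From programs to algorithms *)

(** [minn] keeps the number of cells finite for rewards outside [0, 1]; it has no effect on
    [0, 1]. *)
Definition quantize (R : realType) (M : nat) (x : R) : nat :=
  minn M (Num.truncn (M%:R * x)).

(** [cnt] records how many samples of each arm were already drawn, so that a program reads the same
    entries of the reward table as [run]. *)
Fixpoint exec (R : realType) n A (p : prog n A) (obs : 'I_n -> nat -> R)
    (cnt : 'I_n -> nat) : A * nat :=
  match p with
  | Ret a => (a, 0%N)
  | Smp i M k =>
      let r := exec (k (quantize M (obs i (cnt i)))) obs
                    (fun j => cnt j + (i == j))%N in
      (r.1, r.2.+1)
  end.

Definition feed1 (R : realType) n A (p : prog n A) (y : 'I_n * R) : prog n A :=
  match p with
  | Ret a => Ret a
  | Smp i M k => k (quantize M y.2)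
  end.

Definition feed (R : realType) n A (p : prog n A) (h : seq ('I_n * R)) :=
  foldl (@feed1 R n A) p h.

(* [Ret None] means that the program ran out of fuel: [q] refines [p] when it behaves
   like [p] until [p] gives up. *)
Inductive refines n A : prog n (option A) -> prog n (option A) -> Prop :=
| refines_none q : refines (Ret None) q
| refines_some a : refines (Ret (Some a)) (Ret (Some a))
| refines_smp i M k k' : (forall j, refines (k j) (k' j)) ->
    refines (Smp i M k) (Smp i M k').

Lemma refines_refl n A (p : prog n (option A)) : refines p p.
Proof. by elim: p => [[a|]|i M k IH]; constructor. Qed.

Lemma refines_bind n A B (p : prog n B) (k k' : B -> prog n (option A)) :
  (forall b, refines (k b) (k' b)) -> refines (bind p k) (bind p k').
Proof. by move=> kk'; elim: p => [b|i M c IH] //=; constructor. Qed.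

Lemma refines_feed (R : realType) n A (p q : prog n (option A))
    (h : seq ('I_n * R)) : refines p q -> refines (feed p h) (feed q h).
Proof.
elim: h p q => [//|y h IH] p q pq /=; apply: IH.
by case: pq => [q'|a|i M k k' kk'] /=; [constructor|constructor|exact: kk'].
Qed.

Lemma outs_feed_ret (R : realType) n A (p : prog n A) Q (h : seq ('I_n * R)) a :
  outs p Q -> feed p h = Ret a -> exists2 c, (c <= size h)%N & Q a c.
Proof.
elim: h p Q => [|y h IH] p Q; first by case: p => [b|//] /= Qb [<-]; exists 0%N.
case: p => [b|i M k] /= Qp; last by move=> /(IH _ _ (Qp _)) [c ch Qc]; exists c.+1.
have -> : feed (Ret b) h = Ret b :> prog n A by elim: h {IH}.
by case=> <-; exists 0%N.
Qed.

Section algorithm_of_approximations.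
Variables (R : realType) (n : nat) (p : nat -> prog n (option 'I_n)).
Hypothesis p_mono : forall F F', (F <= F')%N -> refines (p F) (p F').
Hypothesis p_none : forall F, outs (p F) (fun o c => o = None -> (F <= c)%N).
Variable i0 : 'I_n.

(* [p F] draws at least [F] samples before giving up, so [p (size h).+1] still acts
   after the history [h]. *)
Definition alg_of : algorithm R n := fun _ h =>
  match feed (p (size h).+1) h with
  | Ret (Some a) => Stop a
  | Ret None => Stop i0
  | Smp i _ _ => Pull i
  end.

(** The history [h] can use up at most [size h] samples, so [p (size h).+1] has not given up after
    it. As one of the two programs refines the other, they have the same head unless [p F] has given
    up. *)
Lemma alg_of_feed F seeds h : match feed (p F) h with
  | Ret (Some a) => alg_of seeds h = Stop a
  | Ret None => True
  | Smp i _ _ => alg_of seeds h = Pull i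
  end.
Proof.
rewrite /alg_of; have [hF|hF] := leqP (size h).+1 F.
  have := refines_feed h (p_mono hF).
  have nN : feed (p (size h).+1) h <> Ret None.
    move=> /(outs_feed_ret (@p_none _)) [c cs /(_ erefl)].
    by rewrite ltnNge cs.
  move E : (feed (p (size h).+1) h) nN => q nN; move: (feed (p F) h) => q' qq'.
  by case: q q' / qq' E nN.
rewrite ltnS in hF; have := refines_feed h (p_mono (leqW hF)).
move: (feed (p F) h) (feed (p (size h).+1) h) => q q' qq'.
by case: q q' / qq'.
Qed.

Variables (obs : 'I_n -> nat -> R) (seeds : nat -> R).
Let cnt (h : seq ('I_n * R)) := fun i => count (fun y => y.1 == i) h.

Lemma run_exec F t : let r := exec (p F) obs (fun _ => 0%N) in
  (t <= r.2)%N -> let s := run alg_of obs seeds t in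
  [/\ s.2 = None, size s.1 = t &
      exec (feed (p F) s.1) obs (cnt s.1) = (r.1, (r.2 - t)%N)].
Proof.
move=> r; elim: t => [_|t IH tr] /=.
  by split=> //; rewrite /cnt subn0 /=; exact: surjective_pairing.
have [-> st Et] := IH (ltnW tr).
set s := run _ _ _ _ in st Et *.
have := alg_of_feed F (mkseq seeds t.+1) s.1.
case Ef : (feed (p F) s.1) Et => [r0|i M k] /=.
  by case=> _ /eqP; rewrite eq_sym subn_eq0 leqNgt tr.
case=> E1 E2 ->; split; rewrite ?size_rcons ?st//=.
rewrite /feed -cats1 foldl_cat /= -/(feed _ _) Ef /=.
rewrite (_ : cnt _ = (fun j => cnt s.1 j + (i == j))%N); last first.
  by apply/funext => j; rewrite /cnt count_cat /= addn0.
rewrite [LHS]surjective_pairing E1; congr (_, _).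
by rewrite subnS -E2.
Qed.

Lemma run_exec_stop F a m : exec (p F) obs (fun _ => 0%N) = (Some a, m) ->
  let s := run alg_of obs seeds m.+1 in s.2 = Some a /\ size s.1 = m.
Proof.
move=> E /=; have := @run_exec F m; rewrite E /= leqnn => /(_ isT)[-> sm].
set s := run _ _ _ _ in sm *.
have := alg_of_feed F (mkseq seeds m.+1) s.1.
case: (feed (p F) s.1) => [r0|i M k] /=; rewrite subnn => + [] // Er.
by rewrite Er => ->.
Qed.

Lemma run_frozen (alg : algorithm R n) t t' : (t <= t')%N ->
  (run alg obs seeds t).2 <> None ->
  run alg obs seeds t' = run alg obs seeds t.
Proof.
move=> /subnK <-; move: (t' - t)%N => d tN; elim: d => // d IH.
by rewrite addSn /= IH; case: (run alg obs seeds t).2 tN.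
Qed.

Lemma size_run_le (alg : algorithm R n) t t' : (t <= t')%N ->
  (size (run alg obs seeds t).1 <= size (run alg obs seeds t').1)%N.
Proof.
move=> /subnK <-; move: (t' - t)%N => d; elim: d => // d /leq_trans; apply.
rewrite addSn /=; case: (run _ _ _ (d + t)) => h [//|] /=.
by case: (alg _ _) => //= i; rewrite size_rcons.
Qed.

Lemma outputs_within_exec F b N : N < F%:R ->
  outputs_within alg_of obs seeds b N <->
  (let r := exec (p F) obs (fun _ => 0%N) in
   (r.1 == Some b) && (r.2%:R <= N)).
Proof.
move=> NF; case E : (exec (p F) obs (fun _ => 0%N)) => [r0 m] /=; split; last first.
  move=> /andP[/eqP ob mN]; rewrite ob in E.
  by exists m.+1; have [-> ->] := run_exec_stop E.
move=> [t [tb tN]]; case: r0 E => [a|] E.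
  have [Ea Em] := run_exec_stop E.
  have tt : run alg_of obs seeds t = run alg_of obs seeds m.+1.
    have [le|lt] := leqP m.+1 t; first by rewrite -(run_frozen le)// Ea.
    by rewrite -(run_frozen (ltnW lt))// tb.
  by move: tb tN; rewrite tt Ea Em => -[->] ->; rewrite eqxx.
(* The program gave up: it drew at least [F], hence more than [N], samples, and until then the run
   had not stopped. *)
have Fm : (F <= m)%N.
  have : forall A (q : prog n A) (Q : A -> nat -> Prop) c, outs q Q ->
      Q (exec q obs c).1 (exec q obs c).2.
    by move=> A; elim=> [x|i M k IH] Q c //= /(_ _)/(IH _ _ (fun j => c j + (i == j))%N).
  by move=> /(_ _ _ _ (fun _ => 0%N) (@p_none F)); rewrite E; apply.
have [le|lt] := leqP t m.
  by have := @run_exec F t; rewrite E /= tb => /(_ le) [].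
have := size_run_le alg_of (ltnW lt).
have := @run_exec F m; rewrite E /= leqnn => /(_ isT)[_ -> _] ms; have : (m%:R : R) <= N by apply: le_trans tN; rewrite ler_nat.
by move=> /le_lt_trans /(_ NF); rewrite ltr_nat ltnNge Fm.
Qed.

End algorithm_of_approximations.

(** * Cells of the rounding grid *)

Section law.
Variables (R : realType) (n : nat).

Lemma quantize_set (M j : nat) :
  measurable [set x : R | quantize M x = j].
Proof.
have H k : measurable [set x : R | (k < quantize M x)%N].
  have -> : [set x : R | (k < quantize M x)%N] =
      if (k < M)%N then [set x : R | k.+1%:R <= M%:R * x] else set0.
    apply/seteqP; split=> x /=; rewrite leq_min; case: (ltnP k M) => kM //=;
    by rewrite truncn_gt_nat.
  case: ifP => // kM.
  rewrite (_ : [set x | _] = [set` `[(k.+1%:R / M%:R : R), +oo[ ]) //.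
  have M0 : (0 : R) < M%:R by rewrite ltr0n (leq_ltn_trans _ kM).
  apply/seteqP; split=> x /=; rewrite in_itv /= andbT ler_pdivrMr// mulrC//.
rewrite (_ : [set x | _] = (if j is k.+1 then [set x : R | (k < quantize M x)%N] else setT)
    `\` [set x : R | (j < quantize M x)%N]).
  by apply: measurableD; [case: j => [|k]; [exact: measurableT|exact: H]|exact: H].
apply/seteqP; split=> x /=.
  by case: j => [|j] /= ->; split=> //; rewrite ?ltnS ?ltnn.
case: j => [|k] /= [+ /negP]; rewrite -leqNgt; first by rewrite leqn0 => _ /eqP.
by move=> a b; apply/eqP; rewrite eqn_leq b a.
Qed.

Lemma quantize_le (M : nat) (x : R) : (quantize M x <= M)%N.
Proof. exact: geq_minl. Qed.

Lemma quantize_split d (T : measurableType d) (mu : {measure set T -> \bar R})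
    (Y : T -> R) (F : set T) M : measurable_fun setT Y -> measurable F ->
  mu F = (\sum_(j < M.+1) mu (F `&` Y @^-1` [set x | quantize M x = j]))%E.
Proof.
move=> mY mF; rewrite -measure_bigsetU_ord //.
- rewrite -(bigcup_mkord _ (fun j => F `&` Y @^-1` [set x | quantize M x = j])).
  congr (mu _); apply/seteqP; split=> [w Fw|w [j _ []]//].
  by exists (quantize M (Y w)) => //=; rewrite ltnS quantize_le.
- move=> j; apply: measurableI => //.
  by rewrite -[X in measurable X]setTI; apply: mY => //; exact: quantize_set.
- by move=> i j _ _ [w [[_ /= Ei] [_ /= Ej]]]; apply/val_inj; rewrite /= -Ei -Ej.
Qed.

End law.

(** * Law of a program on the reward table *)

Definition qlaw (R : realType) n (D : 'I_n -> probability R R)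
    (i : 'I_n) (M j : nat) : R := fine (D i [set x | quantize M x = j]).

Section exec_law.
Variables (R : realType) (n : nat) (D : 'I_n -> probability R R).
Variables (d : measure_display) (Omega : measurableType d) (P : probability Omega R).
Variables (X : 'I_n -> nat -> Omega -> R).
Hypothesis mX : forall i k, measurable_fun setT (X i k).
Hypothesis indepX : forall (J : seq ('I_n * nat)) (B : 'I_n * nat -> set R),
  uniq J -> (forall s, s \in J -> measurable (B s)) ->
  P (\big[setI/setT]_(s <- J) (X s.1 s.2 @^-1` B s)) =
  (\prod_(s <- J) D s.1 (B s))%E.

Lemma qlaw_ge0 i M j : 0 <= qlaw D i M j.
Proof. exact: fine_ge0. Qed.

Lemma qlawE i M j : (qlaw D i M j)%:E = D i [set x | quantize M x = j].
Proof. by rewrite fineK// fin_num_measure//; exact: quantize_set. Qed.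

Lemma qlaw_sum i M : \sum_(j < M.+1) qlaw D i M j = 1.
Proof.
apply: EFin_inj; rewrite -sumEFin.
transitivity (D i setT); last exact: probability_setT.
rewrite (quantize_split (D i) M (@measurable_id _ _ setT) measurableT).
by apply: eq_bigr => j _; rewrite qlawE setTI.
Qed.

Lemma measurable_preimage i k A : measurable A -> measurable (X i k @^-1` A).
Proof. by move=> mA; rewrite -[X in measurable X]setTI; apply: mX. Qed.

Definition exec_event A (p : prog n A) cnt (ev : A -> nat -> bool) : set Omega :=
  [set w | let r := exec p (fun i k => X i k w) cnt in ev r.1 r.2].

Lemma exec_event_smp A i M (k : nat -> prog n A) cnt ev j :
  exec_event (Smp i M k) cnt ev `&` X i (cnt i) @^-1` [set x | quantize M x = j] =
  X i (cnt i) @^-1` [set x | quantize M x = j] `&`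
  exec_event (k j) (fun i' => cnt i' + (i == i'))%N (fun a c => ev a c.+1).
Proof.
apply/seteqP; split=> w; rewrite /exec_event /= => -[].
  by move=> /[swap] ->.
by move=> Ej; rewrite Ej.
Qed.

Lemma measurable_exec_event A (p : prog n A) cnt ev :
  measurable (exec_event p cnt ev).
Proof.
elim: p cnt ev => [a|i M k IH] cnt ev.
  by rewrite /exec_event /=; case: (ev a 0%N); rewrite ?set_true ?set_false.
set F := exec_event _ _ _.
have -> : F = \big[setU/set0]_(j < M.+1)
    (F `&` X i (cnt i) @^-1` [set x | quantize M x = j]).
  rewrite -(bigcup_mkord _ (fun j => F `&` X i (cnt i) @^-1` [set x | quantize M x = j])).
  apply/seteqP; split=> [w Fw|w [j _ []]//].
  by exists (quantize M (X i (cnt i) w)) => //=; rewrite ltnS quantize_le.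
apply: bigsetU_measurable => j _; rewrite exec_event_smp.
by apply: measurableI => //; apply: measurable_preimage; exact: quantize_set.
Qed.

(* The rectangle over [J] records the past: no sample it involves is drawn again. *)
Lemma exec_law_past A (p : prog n A) cnt ev J B :
  uniq J -> (forall s, s \in J -> measurable (B s)) ->
  (forall s, s \in J -> (s.2 < cnt s.1)%N) ->
  P (\big[setI/setT]_(s <- J) (X s.1 s.2 @^-1` B s) `&` exec_event p cnt ev) =
  (P (\big[setI/setT]_(s <- J) (X s.1 s.2 @^-1` B s)) *
   (Ex (qlaw D) p (fun a c => (ev a c)%:R))%:E)%E.
Proof.
elim: p cnt ev J B => [a|i M k IH] cnt ev J B uJ mB Jcnt.
  rewrite /exec_event /=; case: (ev a 0%N).
    by rewrite set_true setIT mule1.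
  by rewrite set_false setI0 measure0 mule0.
set A' := \big[_/_]_(_ <- _) _.
have mA' : measurable A'.
  rewrite /A' big_seq; apply: bigsetI_measurable => s sJ.
  by apply: measurable_preimage; exact: mB.
set F := exec_event _ _ _.
rewrite (quantize_split P M (@mX i (cnt i))); last first.
  by apply: measurableI => //; exact: measurable_exec_event.
rewrite /= -sumEFin ge0_sume_distrr; last first.
  move=> j _; rewrite lee_fin mulr_ge0 ?qlaw_ge0//.
  apply: (Ex_ge0 qlaw_ge0 qlaw_sum) => a c; exact: ler0n.
apply: eq_bigr => j _.
(* The new sample joins the rectangle. It is fresh, so [s0 :: J] has no repetition and independence
   makes its cell contribute the factor [qlaw D i M j]. *)
pose s0 := (i, cnt i).
pose B' s := if s == s0 then [set x : R | quantize M x = j] else B s.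
have s0J : s0 \notin J by apply/negP => /Jcnt /=; rewrite ltnn.
have eqB s : s \in J -> B' s = B s.
  by rewrite /B'; case: eqP => // ->; rewrite (negbTE s0J).
have EA : A' = \big[setI/setT]_(s <- J) (X s.1 s.2 @^-1` B' s).
  by apply: eq_big_seq => s sJ; rewrite eqB.
have EC : X i (cnt i) @^-1` [set x | quantize M x = j] = X s0.1 s0.2 @^-1` B' s0.
  by rewrite /B' eqxx.
rewrite -setIA exec_event_smp setIA EA EC (setIC _ (X s0.1 s0.2 @^-1` _)).
have -> : X s0.1 s0.2 @^-1` B' s0 `&` \big[setI/setT]_(s <- J) (X s.1 s.2 @^-1` B' s) =
    \big[setI/setT]_(s <- s0 :: J) (X s.1 s.2 @^-1` B' s) by rewrite big_cons.
have u' : uniq (s0 :: J) by rewrite /= s0J.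
have m' s : s \in s0 :: J -> measurable (B' s).
  rewrite inE /B'; case: eqP => [_ _|_ /= /mB//]; exact: quantize_set.
rewrite IH//; last first.
  move=> s; rewrite inE => /orP[/eqP->|/Jcnt sc] /=; first by rewrite eqxx addn1.
  exact: ltn_addr.
rewrite !indepX// ?big_cons; last by move=> s sJ; apply: m'; rewrite inE sJ orbT.
by rewrite [B' s0]/B' eqxx EFinM qlawE -muleA muleCA.
Qed.

Lemma exec_law A (p : prog n A) cnt ev :
  P (exec_event p cnt ev) = (Ex (qlaw D) p (fun a c => (ev a c)%:R))%:E.
Proof.
have := @exec_law_past A p cnt ev [::] (fun _ => setT) isT.
by rewrite big_nil setTI probability_setT mul1e => ->.
Qed.

End exec_law.

(** * Mean and variance of rounded rewards *)

Section quantized_moments.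
Variables (R : realType) (D : probability R R).
Hypothesis D01 : D [set x : R | 0 <= x <= 1] = 1%E.

Let I01 := [set x : R | 0 <= x <= 1].
(** The support condition holds only almost surely. Integrals are moved to [0, 1], where the
    functions at hand are bounded and integrability is automatic. *)
Let E (f : R -> R) : R := \int[D]_(x in I01) f x.

Let mI01 : measurable I01.
Proof.
by rewrite (_ : I01 = [set` `[0 : R, 1]]) //; apply/seteqP; split=> x /=; rewrite in_itv.
Qed.

Let bounded01 (f : R -> R) :=
  measurable_fun setT f /\ exists K : R, forall x : R, 0 <= x <= 1 -> `|f x| <= K.

Let int01 f : bounded01 f -> D.-integrable I01 (EFin \o f).
Proof.
move=> [mf [K fK]]; apply: measurable_bounded_integrable => //.
- exact: (eq_ind_r (fun z => z < +oo)%E (ltry 1) D01).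
- exact: measurable_funTS.
- by exists K; split; [exact: num_real|move=> y Ky x /fK fx; apply: le_trans fx (ltW Ky)].
Qed.

Let E_int f : bounded01 f -> (\int[D]_x (f x)%:E)%E = (E f)%:E.
Proof.
move=> bf; have ifx := int01 bf; have [mf _] := bf.
rewrite /E /Rintegral fineK; last exact: integrable_fin_num.
rewrite [RHS]integral_mkcond; apply: ae_eq_integral => //.
- exact/measurable_EFinP.
- by apply/(measurable_restrictT _ _).1 => //; apply/measurable_EFinP; exact: measurable_funTS.
- exists (~` I01); split; first exact: measurableC.
    have D1 : D I01 = 1%E by exact: D01.
    apply: etrans (probability_setC D mI01) _; apply: etrans (subee (erefl : 1%E \is a fin_num)).
    by congr (_ - _)%E.
  move=> x /= /not_implyP[_ nE] xI; apply: nE.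
  by rewrite patchE; case: ifPn => //; rewrite notin_setE.
Qed.

Let E_le f g : bounded01 f -> bounded01 g ->
  (forall x : R, 0 <= x <= 1 -> f x <= g x) -> E f <= E g.
Proof. by move=> /int01 bf /int01 bg fg; apply: le_Rintegral. Qed.

Let E_D f g : bounded01 f -> bounded01 g -> E (fun x => f x + g x) = E f + E g.
Proof. by move=> /int01 bf /int01 bg; apply: RintegralD. Qed.

Let E_Z a f : bounded01 f -> E (fun x => a * f x) = a * E f.
Proof. by move=> /int01 bf; apply: RintegralZl. Qed.

Let E_cst a : E (fun=> a) = a.
Proof. by rewrite /E Rintegral_cst//; apply: etrans (mulr1 a); congr (_ * _); exact: (congr1 fine D01). Qed.

Let b_id : bounded01 id.
Proof.
by split; [exact: measurable_id|exists 1 => x /andP[x0 x1]; rewrite ger0_norm].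
Qed.

Let b_cst a : bounded01 (fun=> a).
Proof. by split; [exact: measurable_cst|exists `|a|]. Qed.

Let b_D f g : bounded01 f -> bounded01 g -> bounded01 (fun x => f x + g x).
Proof.
move=> [mf [K fK]] [mg [L gL]]; split; first exact: measurable_funD.
exists (K + L) => x x01; apply: le_trans (ler_normD _ _) _.
by rewrite lerD ?fK ?gL.
Qed.

Let b_Z a f : bounded01 f -> bounded01 (fun x => a * f x).
Proof.
move=> [mf [K fK]]; split; first exact: measurable_funM.
by exists (`|a| * K) => x x01; rewrite normrM ler_wpM2l// fK.
Qed.

Let b_sqr f : bounded01 f -> bounded01 (fun x => f x ^+ 2).
Proof.
move=> [mf [K fK]]; split; first exact: measurable_funX.
by exists (K ^+ 2) => x x01; rewrite normrX lerXn2r ?nnegrE ?fK// (le_trans _ (fK _ x01)).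
Qed.

Let b_quantize M (h : nat -> R) : bounded01 (fun x => h (quantize M x)).
Proof.
split; last first.
  exists (\sum_(j < M.+1) `|h j|) => x _.
  have jM : (quantize M x < M.+1)%N by rewrite ltnS quantize_le.
  by rewrite (bigD1 (Ordinal jM))//= lerDl sumr_ge0.
rewrite (_ : (fun x => _) =
  (fun x => \sum_(j < M.+1) h j * \1_[set x | quantize M x = j] x)).
  apply: measurable_sum => j; apply: measurable_funM; first exact: measurable_cst.
  by apply: measurable_indic; exact: quantize_set.
apply/funext => x; have jM : (quantize M x < M.+1)%N by rewrite ltnS quantize_le.
rewrite (bigD1 (Ordinal jM))//= indicE mem_set//= mulr1 big1 ?addr0// => j nj.
rewrite indicE memNset ?mulr0//= => e; move/eqP: nj; apply.
by apply/val_inj; rewrite /= e.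
Qed.

Let E_quantize M (h : nat -> R) :
  E (fun x => h (quantize M x)) =
  \sum_(j < M.+1) fine (D [set x | quantize M x = j]) * h j.
Proof.
apply: EFin_inj; rewrite -E_int//.
transitivity (\int[D]_x (\sum_(j < M.+1)
    ((h j)%:E * (\1_[set x | quantize M x = j] x)%:E)))%E.
  apply: eq_integral => x _; have jM : (quantize M x < M.+1)%N by rewrite ltnS quantize_le.
  rewrite (bigD1 (Ordinal jM))//= indicE mem_set//= mule1 big1 ?adde0// => j nj.
  rewrite indicE memNset ?mule0//= => e; move/eqP: nj; apply.
  by apply/val_inj; rewrite /= e.
have mq j := @quantize_set R M j.
rewrite integral_sum//; last first.
  move=> j; apply: integrableZl => //.
  by apply: integrable_indic => //; rewrite ltey_eq fin_num_measure.
rewrite -sumEFin; apply: eq_bigr => j _.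
rewrite integralZl//; last by apply: integrable_indic => //; rewrite ltey_eq fin_num_measure.
by rewrite integral_indic// setIT EFinM fineK ?fin_num_measure// muleC.
Qed.

Lemma dmeanE : dmean D = E id.
Proof. by rewrite /dmean unlock E_int. Qed.

Lemma dvarE : dvar D = E (fun x => (x - dmean D) ^+ 2).
Proof.
rewrite /dvar /variance unlock unlock -/(dmean D).
rewrite -[RHS]/(fine (E _)%:E) -E_int; last first.
  by apply: (@b_sqr (fun x => x + - dmean D)); apply: b_D.
congr fine; apply: eq_integral => x _.
by rewrite /dmean unlock /= expr2.
Qed.

Lemma dmean_ge0 : 0 <= dmean D.
Proof. by rewrite dmeanE -[leLHS](E_cst 0); apply: E_le => // x /andP[]. Qed.

Lemma dmean_le1 : dmean D <= 1.
Proof. by rewrite dmeanE -[leRHS](E_cst 1); apply: E_le => // x /andP[]. Qed.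

Lemma dvar_ge0 : 0 <= dvar D.
Proof. by apply: fine_ge0; exact: variance_ge0. Qed.

Variable M : nat.
Hypothesis M0 : (0 < M)%N.
Let grid (x : R) : R := (quantize M x)%:R / M%:R.
Let law j := fine (D [set x | quantize M x = j]).
Let m := \sum_(j < M.+1) law j * (j%:R / M%:R).
Let v := \sum_(j < M.+1) law j * (j%:R / M%:R - m) ^+ 2.

Let grid_close x : 0 <= x <= 1 -> grid x <= x <= grid x + M%:R^-1.
Proof.
move=> /andP[x0 x1]; have M0' : (0 : R) < M%:R by rewrite ltr0n.
have Mx0 : 0 <= M%:R * x by rewrite mulr_ge0.
have := truncn_itv Mx0; set t := Num.truncn _ => /andP[tx xt].
have tM : (t <= M)%N.
  by rewrite -(ler_nat R) (le_trans tx)// -[leRHS]mulr1 ler_wpM2l// ltW.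
rewrite /grid /quantize -/t (minn_idPr tM).
rewrite (_ : _ + _ = t.+1%:R / M%:R); last by rewrite -natr1 mulrDl mul1r.
by rewrite ler_pdivrMr// ler_pdivlMr// mulrC tx ltW.
Qed.

Let b_grid : bounded01 grid.
Proof. exact: (@b_quantize M (fun j => j%:R / M%:R)). Qed.

Let E_grid : E grid = m.
Proof. exact: (@E_quantize M (fun j => j%:R / M%:R)). Qed.

Let E_grid_sqr a : E (fun x => (grid x - a) ^+ 2) =
  \sum_(j < M.+1) law j * (j%:R / M%:R - a) ^+ 2.
Proof. exact: (@E_quantize M (fun j => (j%:R / M%:R - a) ^+ 2)). Qed.

Let b_sqrB f a : bounded01 f -> bounded01 (fun x => (f x - a) ^+ 2).
Proof. by move=> bf; apply: (@b_sqr (fun x => f x + - a)); apply: b_D. Qed.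

Lemma quantized_mean : m <= dmean D <= m + M%:R^-1.
Proof.
rewrite dmeanE -E_grid; apply/andP; split.
  by apply: E_le => // x /grid_close/andP[].
rewrite -[X in _ <= _ + X](E_cst M%:R^-1) -E_D//.
by apply: E_le => [//||x /grid_close/andP[//]]; exact: b_D.
Qed.

(** The two sides differ by [(E f - a) ^+ 2]. *)
Let E_sqr_shift f a : bounded01 f -> E (fun x => (f x - E f) ^+ 2) <= E (fun x => (f x - a) ^+ 2).
Proof.
move=> bf; have -> : (fun x => (f x - a) ^+ 2) =
    (fun x => (f x - E f) ^+ 2 + (2 * (E f - a) * f x + (a ^+ 2 - E f ^+ 2))).
  by apply/funext => x; ring.
rewrite E_D ?E_D ?E_Z ?E_cst//; [|exact: b_Z|exact: b_sqrB|by apply: b_D => //; exact: b_Z].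
rewrite lerDl (_ : _ + _ = (E f - a) ^+ 2) ?sqr_ge0//; ring.
Qed.

Let E_sqr_close f g a K : bounded01 f -> bounded01 g ->
  (forall x : R, 0 <= x <= 1 -> `|f x - g x| <= K) ->
  E (fun x => (f x - a) ^+ 2) <= 2 * E (fun x => (g x - a) ^+ 2) + 2 * K ^+ 2.
Proof.
move=> bf bg fg; rewrite -E_Z; last exact: b_sqrB.
rewrite -[X in _ + X]E_cst -E_D//; last by apply: b_Z; exact: b_sqrB.
apply: E_le => [||x /fg]; [exact: b_sqrB|by apply: b_D => //; apply: b_Z; exact: b_sqrB|].
rewrite ler_norml => /andP[Ku uK].
have h1 : 0 <= (K - (f x - g x)) * (K + (f x - g x)) by apply: mulr_ge0; lra.
have h2 : 0 <= (f x - g x - (g x - a)) ^+ 2 by exact: sqr_ge0.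
nra.
Qed.

(** Recentre at [dmean D], then apply (x + y)^2 <= 2 x^2 + 2 y^2 to a rounding error of at most 1 /
    M. The factor 2 is harmless: weights matter only up to constants. *)
Lemma quantized_var_le : v <= 2 * dvar D + 2 * M%:R^-1 ^+ 2.
Proof.
rewrite /v -E_grid_sqr -E_grid dvarE.
apply: le_trans (E_sqr_shift (dmean D) b_grid) _.
apply: E_sqr_close => // x /grid_close/andP[? ?]; rewrite ler_norml; apply/andP; split; lra.
Qed.

Lemma var_le_quantized : dvar D <= 2 * v + 2 * M%:R^-1 ^+ 2.
Proof.
rewrite /v -E_grid_sqr dvarE dmeanE.
apply: le_trans (E_sqr_shift m b_id) _.
apply: E_sqr_close => // x /grid_close/andP[? ?]; rewrite ler_norml; apply/andP; split; lra.
Qed.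

End quantized_moments.

(** * Estimating the variance and the mean of an arm *)

Section expR_bounds.
Variable R : realType.
Implicit Types x t : R.

Lemma expR_le_inv x : x < 1 -> expR x <= (1 - x)^-1.
Proof.
move=> x1; rewrite -[x]opprK expRN opprK lef_pV2 ?posrE ?expR_gt0 ?subr_gt0//.
exact: expR_ge1Dx.
Qed.

Lemma expR_le_quadratic x : x <= 1 / 2 -> expR x <= 1 + x + 2 * x ^+ 2.
Proof.
move=> x2; apply: le_trans (@expR_le_inv x _) _; first by lra.
rewrite -[leLHS]mul1r ler_pdivrMr; last by lra.
have : 0 <= x ^+ 2 * (1 - 2 * x) by rewrite mulr_ge0 ?sqr_ge0//; lra.
nra.
Qed.

Lemma posr_le_expR (a t : R) : 0 < a -> Num.max 0 t <= expR (a * t) / a.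
Proof.
move=> a0; rewrite ge_max divr_ge0 ?expR_ge0 ?(ltW a0)//=.
rewrite ler_pdivlMr// mulrC; apply: le_trans (expR_ge1Dx _); lra.
Qed.

End expR_bounds.

Definition nsamp (R : realType) (x : R) : nat := (Num.truncn x).+1.

Lemma nsampP (R : realType) (x : R) : 0 <= x -> x <= (nsamp x)%:R <= x + 1.
Proof.
move=> x0; have /andP[tx xt] := truncn_itv x0.
by rewrite /nsamp (ltW xt) -natr1 lerD2r.
Qed.

Section estimation.
Variables (R : realType) (n : nat) (pr : 'I_n -> nat -> nat -> R).
Hypothesis pr_ge0 : forall i M j, 0 <= pr i M j.
Hypothesis pr_sum : forall i M, \sum_(j < M.+1) pr i M j = 1.

Definition draw (i : 'I_n) (M : nat) : prog n R := Smp i M (fun j => Ret (j%:R / M%:R)).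

(** Half the squared difference of two independent draws: an unbiased estimator of the variance that
    requires no estimate of the mean. *)
Definition draw_sq (i : 'I_n) (M : nat) : prog n R :=
  Smp i M (fun j => Smp i M (fun j' => Ret ((j%:R / M%:R - j'%:R / M%:R) ^+ 2 / 2))).

Definition qmean i M := \sum_(j < M.+1) pr i M j * (j%:R / M%:R).
Definition qvar i M := \sum_(j < M.+1) pr i M j * (j%:R / M%:R - qmean i M) ^+ 2.

Variables (i : 'I_n) (M : nat).
Hypothesis M0 : (0 < M)%N.
Let m := qmean i M.
Let v := qvar i M.

Let grid01 (j : 'I_M.+1) : 0 <= (j%:R / M%:R : R) <= 1.
Proof.
rewrite divr_ge0//= ler_pdivrMr ?ltr0n// mul1r ler_nat.
by have := ltn_ord j; rewrite ltnS.
Qed.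

Lemma qvar_ge0 : 0 <= v.
Proof. by apply: sumr_ge0 => j _; rewrite mulr_ge0 ?sqr_ge0. Qed.

Lemma qmean01 : 0 <= m <= 1.
Proof.
rewrite sumr_ge0/=; last by move=> j _; rewrite mulr_ge0//; have /andP[] := grid01 j.
rewrite -(pr_sum i M); apply: ler_sum => j _.
by rewrite -[leRHS]mulr1 ler_wpM2l//; have /andP[] := grid01 j.
Qed.

Let sum_pr_cst a : \sum_(j < M.+1) pr i M j * a = a.
Proof. by rewrite -mulr_suml pr_sum mul1r. Qed.

Let qvarE : v = \sum_(j < M.+1) pr i M j * (j%:R / M%:R) ^+ 2 - m ^+ 2.
Proof.
transitivity (\sum_(j < M.+1) (pr i M j * (j%:R / M%:R) ^+ 2 +
    (- (2 * m) * (pr i M j * (j%:R / M%:R)) + pr i M j * m ^+ 2))).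
  by apply: eq_bigr => j _; rewrite -/m; ring.
rewrite !big_split/= sum_pr_cst -mulr_sumr -/(qmean i M) -/m; ring.
Qed.

Lemma Ex_draw_sq : Ex pr (draw_sq i M) (fun z _ => z) = v.
Proof.
rewrite qvarE /=.
set e := \sum_(j < M.+1) pr i M j * (j%:R / M%:R) ^+ 2.
transitivity (\sum_(j < M.+1) (2^-1 * (pr i M j * (j%:R / M%:R) ^+ 2) +
    (- m * (pr i M j * (j%:R / M%:R)) + pr i M j * (e / 2)))).
  apply: eq_bigr => j _.
  rewrite (_ : \sum_(_ < _) _ = (j%:R / M%:R) ^+ 2 / 2 + (- (j%:R / M%:R) * m + e / 2)).
    by ring.
  transitivity (\sum_(j' < M.+1) (pr i M j' * ((j%:R / M%:R) ^+ 2 / 2) +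
     (- (j%:R / M%:R) * (pr i M j' * (j'%:R / M%:R)) +
      2^-1 * (pr i M j' * (j'%:R / M%:R) ^+ 2)))).
    by apply: eq_bigr => j' _; lra.
  by rewrite !big_split/= sum_pr_cst -!mulr_sumr -/(qmean i M) -/m -/e (mulrC e).
rewrite !big_split/= sum_pr_cst -!mulr_sumr -/(qmean i M) -/m -/e; lra.
Qed.

Lemma le_Ex_draw_sq (f g : R -> R) : (forall z, 0 <= z <= 1 / 2 -> f z <= g z) ->
  Ex pr (draw_sq i M) (fun z _ => f z) <= Ex pr (draw_sq i M) (fun z _ => g z).
Proof.
move=> fg /=; apply: ler_sum => j _; apply: ler_wpM2l => //.
apply: ler_sum => j' _; apply: ler_wpM2l => //.
have /andP[? ?] := grid01 j; have /andP[? ?] := grid01 j'.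
apply: fg; rewrite divr_ge0 ?sqr_ge0//=.
set x := _ - _; have : 0 <= (1 - x) * (1 + x) by apply: mulr_ge0; rewrite /x; lra.
nra.
Qed.

Lemma mgf_draw (a : R) : `|a| <= 1 / 2 ->
  Ex pr (draw i M) (fun x _ => expR (a * (x - m))) <= expR (2 * a ^+ 2 * v).
Proof.
rewrite ler_norml => /andP[a1 a2] /=.
apply: (@le_trans _ _ (1 + 2 * a ^+ 2 * v)); last exact: expR_ge1Dx.
apply: (@le_trans _ _ (\sum_(j < M.+1) (pr i M j * (1 - a * m) +
   (a * (pr i M j * (j%:R / M%:R)) + 2 * a ^+ 2 * (pr i M j * (j%:R / M%:R - m) ^+ 2))))).
  apply: ler_sum => j _.
  rewrite [leRHS](_ : _ = pr i M j *
    (1 + a * (j%:R / M%:R - m) + 2 * (a * (j%:R / M%:R - m)) ^+ 2)); last by ring.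
  apply: ler_wpM2l => //; apply: expR_le_quadratic.
  have /andP[? ?] := grid01 j; have /andP[? ?] := qmean01.
  have : 0 <= (1 / 2 - a) * (1 + (j%:R / M%:R - m)) by apply: mulr_ge0; lra.
  have : 0 <= (1 / 2 + a) * (1 - (j%:R / M%:R - m)) by apply: mulr_ge0; lra.
  nra.
by rewrite !big_split/= sum_pr_cst -!mulr_sumr -/(qmean i M) -/m -/(qvar i M) -/v; lra.
Qed.

Lemma mgf_draw_sum (a : R) N : `|a| <= 1 / 2 ->
  Ex pr (sum_prog N (draw i M)) (fun s _ => expR (a * (s - N%:R * m))) <=
  expR (2 * a ^+ 2 * v * N%:R).
Proof.
move=> a2.
under eq_fun do under eq_fun do rewrite mulrBr expRD mulrC.
rewrite ExZ Ex_expR_sum_prog.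
rewrite (_ : - (a * _) = N%:R * (- (a * m))); last by ring.
rewrite expRM_natl -exprMn -ExZ [_ * N%:R]mulrC expRM_natl.
rewrite lerXn2r ?nnegrE ?expR_ge0//.
  by apply: Ex_ge0 => // x _; rewrite mulr_ge0 ?expR_ge0.
apply: le_trans (mgf_draw a2); apply: le_Ex => // x _.
by rewrite -expRD (_ : _ + _ = a * (x - m))//; ring.
Qed.

(** The Chernoff exponent [2 * a ^+ 2 * v - a * x] is minimal at [x / (4 * v)]; the additional
    [2 * x] in the denominator keeps [a] within the range of [mgf_draw]. *)
Let tail_rate (x : R) : 0 < x -> let a := x / (4 * v + 2 * x) in
  [/\ 0 <= a, a <= 1 / 2 & 2 * a ^+ 2 * v - a * x <= - (x ^+ 2 / (8 * v + 4 * x))].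
Proof.
move=> x0 a; have v0 : 0 <= v := qvar_ge0; have d0 : 0 < 4 * v + 2 * x by lra.
have a0 : 0 <= a by rewrite divr_ge0 ?ltW.
have ad : a * (4 * v + 2 * x) = x by rewrite /a divfK ?gt_eqF.
split=> //; first by rewrite /a ler_pdivrMr//; lra.
have -> : x ^+ 2 / (8 * v + 4 * x) = a * x / 2.
  by rewrite /a; field; apply/andP; split; rewrite gt_eqF//; lra.
have : 0 <= a ^+ 2 * x by rewrite mulr_ge0 ?sqr_ge0// ltW.
have : a * (a * (4 * v + 2 * x)) = a * x by rewrite ad.
nra.
Qed.

Lemma mean_upper_tail (x : R) N : 0 < x ->
  Ex pr (sum_prog N (draw i M)) (fun s _ => (N%:R * (m + x) <= s)%R%:R) <=
  expR (- (N%:R * (x ^+ 2 / (8 * v + 4 * x)))).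
Proof.
move=> x0; have := tail_rate x0; set a := x / _ => -[a0 a2 rate].
apply: (@le_trans _ _ (expR (- (a * (N%:R * x))) *
  Ex pr (sum_prog N (draw i M)) (fun s _ => expR (a * (s - N%:R * m))))).
  rewrite -ExZ; apply: le_Ex => // s _.
  rewrite -expRD; case: (leP (N%:R * (m + x)) s) => [xs|_]; last exact: expR_ge0.
  rewrite -[leLHS]expR0 ler_expR [leRHS](_ : _ = a * (s - N%:R * (m + x))); last by ring.
  by rewrite mulr_ge0// subr_ge0.
apply: (@le_trans _ _ (expR (- (a * (N%:R * x))) * expR (2 * a ^+ 2 * v * N%:R))).
  by rewrite ler_wpM2l ?expR_ge0// mgf_draw_sum// ger0_norm.
rewrite -expRD ler_expR.
have : 0 <= N%:R * (- (x ^+ 2 / (8 * v + 4 * x)) - (2 * a ^+ 2 * v - a * x)).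
  by rewrite mulr_ge0// subr_ge0.
by nra.
Qed.

Lemma mean_lower_tail (x : R) N : 0 < x ->
  Ex pr (sum_prog N (draw i M)) (fun s _ => (s <= N%:R * (m - x))%R%:R) <=
  expR (- (N%:R * (x ^+ 2 / (8 * v + 4 * x)))).
Proof.
move=> x0; have := tail_rate x0; set a := x / _ => -[a0 a2 rate].
apply: (@le_trans _ _ (expR (- (a * (N%:R * x))) *
  Ex pr (sum_prog N (draw i M)) (fun s _ => expR (- a * (s - N%:R * m))))).
  rewrite -ExZ; apply: le_Ex => // s _.
  rewrite -expRD; case: (leP s (N%:R * (m - x))) => [xs|_]; last exact: expR_ge0.
  rewrite -[leLHS]expR0 ler_expR [leRHS](_ : _ = a * (N%:R * (m - x) - s)); last by ring.
  by rewrite mulr_ge0// subr_ge0.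
apply: (@le_trans _ _ (expR (- (a * (N%:R * x))) * expR (2 * (- a) ^+ 2 * v * N%:R))).
  by rewrite ler_wpM2l ?expR_ge0// mgf_draw_sum// normrN ger0_norm.
rewrite -expRD ler_expR sqrrN.
have : 0 <= N%:R * (- (x ^+ 2 / (8 * v + 4 * x)) - (2 * a ^+ 2 * v - a * x)).
  by rewrite mulr_ge0// subr_ge0.
by nra.
Qed.

Variable eps : R.
Hypothesis eps0 : 0 < eps.
Hypothesis eps1 : eps <= 1.

(* Up to a constant, [weight * L] samples estimate the mean within [eps / 2] with error
   probability [expR (- L)]. *)
Definition weight := v / eps ^+ 2 + 1 / eps.
Let w := weight.

Lemma weight_gt0 : 0 < w.
Proof. by rewrite ltr_wpDl ?divr_ge0 ?qvar_ge0 ?exprn_ge0 ?ltW// divr_gt0. Qed.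

Let eps_rate (L : R) N : 0 <= L -> 32 * w * L <= N%:R ->
  expR (- (N%:R * ((eps / 2) ^+ 2 / (8 * v + 4 * (eps / 2))))) <= expR (- L).
Proof.
move=> L0 LN; rewrite ler_expR lerN2; have v0 : 0 <= v := qvar_ge0.
have -> : (eps / 2) ^+ 2 / (8 * v + 4 * (eps / 2)) = (32 * (v / eps ^+ 2) + 8 / eps)^-1.
  by have e0 := eps0; field; apply/and3P; split; rewrite gt_eqF//; lra.
have d0 : 0 < 32 * (v / eps ^+ 2) + 8 / eps.
  by rewrite ltr_wpDl ?mulr_gt0 ?invr_gt0// mulr_ge0// divr_ge0 ?exprn_ge0 ?(ltW eps0).
rewrite ler_pdivlMr//; apply: le_trans LN.
have := mulr_ge0 L0 (ltW (divr_gt0 (ltr0Sn R 23) eps0)).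
rewrite /w /weight; lra.
Qed.

Lemma mean_upper_eps (L thr : R) N : 0 <= L -> 32 * w * L <= N%:R -> m + eps / 2 <= thr ->
  Ex pr (sum_prog N (draw i M)) (fun s _ => (N%:R * thr <= s)%R%:R) <= expR (- L).
Proof.
move=> L0 LN mthr; have e0 := eps0; apply: le_trans (eps_rate L0 LN).
apply: le_trans (mean_upper_tail N _); last by lra.
apply: le_Ex => // s _; rewrite ler_nat.
case: (leP (N%:R * thr)) => // ts; rewrite (le_trans _ ts)// ler_wpM2l//.
Qed.

Lemma mean_lower_eps (L thr : R) N : 0 <= L -> 32 * w * L <= N%:R -> thr <= m - eps / 2 ->
  Ex pr (sum_prog N (draw i M)) (fun s _ => (~~ (N%:R * thr <= s)%R)%:R) <= expR (- L).
Proof.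
move=> L0 LN mthr; have e0 := eps0; apply: le_trans (eps_rate L0 LN).
apply: le_trans (mean_lower_tail N _); last by lra.
apply: le_Ex => // s _; rewrite ler_nat -ltNge.
case: (ltP s) => // ts; rewrite (le_trans (ltW ts))// ler_wpM2l//.
Qed.

Let Ex_affine_draw_sq (a b : R) :
  Ex pr (draw_sq i M) (fun z _ => a + b * z) = a + b * v.
Proof. by rewrite ExD ExZ Ex_cst// Ex_draw_sq. Qed.

Lemma mgf_draw_sq_neg N : Ex pr (sum_prog N (draw_sq i M)) (fun s _ => expR (-1 * s)) <=
  expR (N%:R * (- (v / 2))).
Proof.
rewrite Ex_expR_sum_prog expRM_natl lerXn2r ?nnegrE ?expR_ge0//.
  by apply: Ex_ge0 => // x _; exact: expR_ge0.
apply: (@le_trans _ _ (1 + - 2^-1 * v)); last first.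
  by apply: le_trans (expR_ge1Dx _); lra.
rewrite -Ex_affine_draw_sq; apply: (@le_Ex_draw_sq (fun z => expR (-1 * z)) (fun z => 1 + - 2^-1 * z)).
move=> z /andP[z0 z2]; rewrite mulN1r; apply: le_trans (@expR_le_inv _ (- z) _) _; first by lra.
by rewrite -[leLHS]mul1r ler_pdivrMr; [nra|lra].
Qed.

Lemma mgf_draw_sq_pos N : Ex pr (sum_prog N (draw_sq i M)) (fun s _ => expR (1 * s)) <=
  expR (N%:R * (2 * v)).
Proof.
rewrite Ex_expR_sum_prog expRM_natl lerXn2r ?nnegrE ?expR_ge0//.
  by apply: Ex_ge0 => // x _; exact: expR_ge0.
apply: (@le_trans _ _ (1 + 2 * v)); last exact: expR_ge1Dx.
rewrite -Ex_affine_draw_sq; apply: (@le_Ex_draw_sq (fun z => expR (1 * z)) (fun z => 1 + 2 * z)).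
move=> z /andP[z0 z2]; rewrite mul1r; apply: le_trans (@expR_le_inv _ z _) _; first by lra.
by rewrite -[leLHS]mul1r ler_pdivrMr; [nra|lra].
Qed.

(** A number of draws of order [L / eps] suffices, whatever the variance: because of the term
    [1 / eps] in the weight, the variance is needed only up to a constant factor and an additive
    error of order [eps]. *)
Definition weight_est (L : R) : prog n R :=
  let N := nsamp (2 * L / eps) in
  bind (sum_prog N (draw_sq i M)) (fun s => Ret (s / N%:R / eps ^+ 2 + 1 / eps)).

Let N_pos (L : R) : 0 <= L -> let N := nsamp (2 * L / eps) in
  0 < N%:R :> R /\ 2 * L <= N%:R * eps.
Proof.
move=> L0 N; have : 0 <= 2 * L / eps by rewrite divr_ge0 ?mulr_ge0// ltW.
move=> /nsampP/andP[+ _]; rewrite ler_pdivrMr// => ->.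
Qed.

Let Ex_weight_estE (L : R) (f : R -> R) : let N := nsamp (2 * L / eps) in
  Ex pr (weight_est L) (fun w' _ => f w') =
  Ex pr (sum_prog N (draw_sq i M)) (fun s _ => f (s / N%:R / eps ^+ 2 + 1 / eps)).
Proof. exact: Ex_bind. Qed.

Lemma Ex_weight_est (L : R) : Ex pr (weight_est L) (fun w' _ => w') = w.
Proof.
rewrite (Ex_weight_estE L id); set N := nsamp _; rewrite ExD Ex_cst//.
have -> : (fun (s : R) (c : nat) => s / N%:R / eps ^+ 2) =
    (fun s c => (N%:R^-1 / eps ^+ 2) * s).
  by apply/funext => s; apply/funext => c; ring.
rewrite ExZ Ex_sum_prog// Ex_draw_sq /w /weight; congr (_ + _).
have N0 : N%:R != 0 :> R by rewrite pnatr_eq0.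
by rewrite mulrACA mulVf// mul1r mulrC.
Qed.

Lemma weight_est_low (L : R) : 0 <= L ->
  Ex pr (weight_est L) (fun w' _ => (w' < w / 4)%R%:R) <= expR (- L).
Proof.
move=> L0; have [] := N_pos L0; set N := nsamp _ => N0 LN.
rewrite (Ex_weight_estE L (fun w' => (w' < w / 4)%R%:R)) -/N.
have e0 := eps0; have v0 : 0 <= v := qvar_ge0.
apply: (@le_trans _ _ (expR (N%:R * (v / 4 - 3 / 4 * eps)) *
  Ex pr (sum_prog N (draw_sq i M)) (fun s _ => expR (-1 * s)))).
  rewrite -ExZ; apply: le_Ex => // s _; rewrite -expRD; case: ltP => [sw|_]; last exact: expR_ge0.
  rewrite -[leLHS]expR0 ler_expR.
  have : s / N%:R < v / 4 - 3 / 4 * eps.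
    have : (s / N%:R / eps ^+ 2 + 1 / eps) * eps ^+ 2 < w / 4 * eps ^+ 2.
      by rewrite ltr_pM2r// exprn_gt0.
    rewrite mulrDl divfK ?expf_neq0 ?gt_eqF// /w /weight.
    rewrite (_ : (v / _ + _) / 4 * _ = v / 4 + eps / 4); last by field; rewrite gt_eqF.
    by rewrite (_ : 1 / eps * _ = eps); [lra|field; rewrite gt_eqF].
  by rewrite ltr_pdivrMr//; lra.
apply: (@le_trans _ _ (expR (N%:R * (v / 4 - 3 / 4 * eps)) * expR (N%:R * (- (v / 2))))).
  by rewrite ler_wpM2l ?expR_ge0// mgf_draw_sq_neg.
have Nv : 0 <= N%:R * v by rewrite mulr_ge0 ?(ltW N0).
rewrite -expRD ler_expR.
lra.
Qed.

Let high_aux (L : R) (s : R) : 0 <= L -> let N := nsamp (2 * L / eps) in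
  expR (N%:R * (s / N%:R - 3 * v - 2 * eps)) =
  expR (- (N%:R * (3 * v + 2 * eps))) * expR (1 * s).
Proof.
move=> /N_pos[+ _] N; rewrite -/N => N0; rewrite -expRD; congr expR.
by field; rewrite gt_eqF.
Qed.

Let high_bound (L : R) N : N = nsamp (2 * L / eps) -> 0 <= L ->
  Ex pr (sum_prog N (draw_sq i M)) (fun s _ =>
     expR (N%:R * (s / N%:R - 3 * v - 2 * eps))) <= expR (- (4 * L)).
Proof.
move=> -> L0; have [] := N_pos L0; set N' := nsamp _ => N0 LN.
under eq_fun do under eq_fun do rewrite (high_aux _ L0) -/N'.
rewrite ExZ.
apply: (@le_trans _ _ (expR (- (N'%:R * (3 * v + 2 * eps))) * expR (N'%:R * (2 * v)))).
  by rewrite ler_wpM2l ?expR_ge0// mgf_draw_sq_pos.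
have v0 : 0 <= v := qvar_ge0.
have Nv : 0 <= N'%:R * v by rewrite mulr_ge0 ?(ltW N0).
rewrite -expRD ler_expR.
lra.
Qed.

Let weight_est_sub (N : nat) (s : R) :
  s / N%:R / eps ^+ 2 + 1 / eps - 3 * w = (s / N%:R - 3 * v - 2 * eps) / eps ^+ 2.
Proof. by rewrite /w /weight; move: (s / N%:R) => x; field; rewrite gt_eqF. Qed.

Lemma weight_est_high (L : R) : 0 <= L ->
  Ex pr (weight_est L) (fun w' _ => (3 * w < w')%R%:R) <= expR (- L).
Proof.
move=> L0; rewrite (Ex_weight_estE L (fun w' => (3 * w < w')%R%:R)).
apply: le_trans (le_trans (high_bound erefl L0) _); last first.
  by rewrite ler_expR; lra.
apply: le_Ex => // s _; case: ltP => [sw|_]; last exact: expR_ge0.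
rewrite -[leLHS]expR0 ler_expR mulr_ge0//.
move: sw; rewrite -subr_gt0 weight_est_sub pmulr_lgt0 ?invr_gt0 ?exprn_gt0//.
exact: ltW.
Qed.

(** The cost of a round is proportional to the estimates, so a tail probability does not suffice:
    the expected overshoot must be small compared with [w]. It follows from [posr_le_expR] with
    [a = N * eps ^+ 2], since [1 / a <= 1 / eps <= w]. *)
Lemma weight_est_excess (L : R) : 1 / 2 <= L ->
  Ex pr (weight_est L) (fun w' _ => Num.max 0 (w' - 3 * w)) <= expR (- L) * w.
Proof.
move=> L2; have L0 : 0 <= L by lra.
have [] := N_pos L0; set N := nsamp _ => N0 LN.
rewrite (Ex_weight_estE L (fun w' => Num.max 0 (w' - 3 * w))) -/N.
have e0 := eps0.
apply: (@le_trans _ _ ((N%:R * eps ^+ 2)^-1 *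
   Ex pr (sum_prog N (draw_sq i M)) (fun s _ => expR (N%:R * (s / N%:R - 3 * v - 2 * eps))))).
  rewrite -ExZ; apply: le_Ex => // s _; rewrite weight_est_sub.
  have Ne : 0 < N%:R * eps ^+ 2 by rewrite mulr_gt0 ?exprn_gt0.
  apply: le_trans (posr_le_expR _ Ne) _; rewrite mulrC.
  rewrite (_ : N%:R * eps ^+ 2 * _ = N%:R * (s / N%:R - 3 * v - 2 * eps))//.
  by move: (_ - _ - _) => x; field; rewrite gt_eqF.
apply: (@le_trans _ _ ((N%:R * eps ^+ 2)^-1 * expR (- (4 * L)))).
  by rewrite ler_wpM2l ?invr_ge0 ?mulr_ge0 ?exprn_ge0 ?(ltW e0)//; exact: high_bound.
rewrite mulrC ler_pM ?expR_ge0 ?invr_ge0 ?mulr_ge0 ?exprn_ge0 ?(ltW e0)//.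
  by rewrite ler_expR; lra.
apply: (@le_trans _ _ (1 / eps)).
  rewrite div1r lef_pV2 ?posrE ?mulr_gt0 ?exprn_gt0// expr2 mulrA -[leLHS]mul1r ler_wpM2r ?(ltW e0)//.
  by lra.
by rewrite /w /weight lerDr divr_ge0 ?qvar_ge0 ?exprn_ge0 ?(ltW e0).
Qed.

Lemma outs_weight_est (L : R) : 1 <= L ->
  outs (weight_est L) (fun w' c => 1 / eps <= w' /\ (c%:R : R) <= 6 * L / eps).
Proof.
move=> L1; have [] := @N_pos L; first by lra.
rewrite /weight_est; set N := nsamp _ => N0 LN; apply: outs_bind.
have Hc : outs (sum_prog N (draw_sq i M)) (fun _ c => c = (N * 2)%N).
  by apply: outs_sum_prog => j j'.
have Hs k : outs (sum_prog k (draw_sq i M)) (fun s _ => 0 <= s).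
  elim: k => //= k IH j j'; apply: outs_bind; apply: outs_imp IH => s c s0 /=.
  by rewrite addr_ge0// divr_ge0// sqr_ge0.
apply: outs_imp (outs_and Hc (Hs N)) => s c [-> s0] /=.
have e0 := eps0; have e1 := eps1; split.
  by rewrite lerDr !divr_ge0// ?exprn_ge0 ?ltW.
have : 0 <= 2 * L / eps by rewrite divr_ge0 ?mulr_ge0//; lra.
move=> /nsampP/andP[_]; rewrite -/N addn0 natrM => N1.
have : 1 <= L / eps by rewrite ler_pdivlMr//; nra.
lra.
Qed.

(* The first check makes the outcome reliable even when [what] underestimates the
   true weight, while keeping the number of samples proportional to [what]. *)
Definition trial (what thr L : R) : prog n bool :=
  bind (weight_est L) (fun w' => if 12 * what < w' then Ret false else
    let N := nsamp (1536 * what * L) in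
    bind (sum_prog N (draw i M)) (fun s => Ret (N%:R * thr <= s))).

(** 1543 is 1536 for the mean, 6 for the check and 1 for the rounding in [nsamp]. *)
Lemma outs_trial (what thr L : R) : 1 <= L -> 1 / eps <= what ->
  outs (trial what thr L) (fun _ c => (c%:R : R) <= 1543 * what * L).
Proof.
move=> L1 ew; have e0 := eps0; have e1 := eps1.
have ie : 1 <= 1 / eps by rewrite ler_pdivlMr// mul1r.
have wL : 1 <= what * L by rewrite -[leLHS]mulr1 ler_pM//; lra.
have eL : L / eps <= what * L by rewrite mulrC ler_wpM2r//; lra.
apply: outs_bind; apply: outs_imp (outs_weight_est L1) => w' c [_ cL].
case: ifP => _; first by rewrite /= addn0; lra.
set N := nsamp _; apply: outs_bind.
have Hc : outs (sum_prog N (draw i M)) (fun _ c => c = (N * 1)%N).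
  by apply: outs_sum_prog.
apply: outs_imp Hc => s c' -> /=; rewrite muln1 addn0 natrD.
have : 0 <= 1536 * what * L by lra.
by move=> /nsampP/andP[_]; rewrite -/N; lra.
Qed.

Let ifb (b : bool) (x y : prog n bool) f :
  Ex pr (if b then x else y) f = if b then Ex pr x f else Ex pr y f.
Proof. by case: b. Qed.

Lemma trial_pass (what thr L : R) : 0 <= L -> m + eps / 2 <= thr ->
  Ex pr (trial what thr L) (fun b _ => b%:R) <= expR (- L).
Proof.
move=> L0 mthr; rewrite /trial Ex_bind; set N := nsamp _.
apply: (@le_trans _ _ (Ex pr (weight_est L) (fun w' _ => if 12 * what < w' then 0 else
    Ex pr (sum_prog N (draw i M)) (fun s _ => (N%:R * thr <= s)%R%:R)))).
  by apply: le_Ex => // w' c; rewrite ifb; case: ifP => // _; rewrite Ex_bind.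
(* As 1536 = 32 * 48, a value [what >= w / 48] provides the [32 * w * L] samples that
   [mean_upper_eps] requires. Below that, getting through the check means [w' <= 12 * what < w / 4],
   a rare underestimate. *)
have [lw|wl] := leP (w / 48) what.
  apply: Ex_le => // w' _; case: ifP => _; first exact: expR_ge0.
  apply: mean_upper_eps => //.
  have w0 : 0 < w := weight_gt0.
  have what0 : 0 <= what by lra.
  have wL : 0 <= what * L by rewrite mulr_ge0.
  have dL : 0 <= (48 * what - w) * L by rewrite mulr_ge0//; lra.
  have /nsampP/andP[+ _] : 0 <= 1536 * what * L by lra.
  by apply: le_trans; lra.
apply: le_trans (weight_est_low L0); apply: le_Ex => // w' _.
case: ifPn => [//|]; rewrite -leNgt => ww.
rewrite (_ : w' < w / 4); last by lra.
by apply: Ex_le => // s _; rewrite lern1; case: (_ <= s).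
Qed.

(** Two sources of error: since [3 * w <= 12 * what], the check rejects only if [w'] exceeds
    [3 * w]; otherwise the empirical mean must be too low. *)
Lemma trial_fail (what thr L : R) : 0 <= L -> thr <= m - eps / 2 -> w / 4 <= what ->
  Ex pr (trial what thr L) (fun b _ => (~~ b)%:R) <= 2 * expR (- L).
Proof.
move=> L0 mthr ww; rewrite /trial Ex_bind; set N := nsamp _.
apply: (@le_trans _ _ (Ex pr (weight_est L) (fun w' _ => (3 * w < w')%R%:R + expR (- L)))).
  apply: le_Ex => // w' _; rewrite ifb; case: ifP => [lt|_].
    by rewrite (_ : 3 * w < w') /= ?lerDl ?expR_ge0//; lra.
  rewrite Ex_bind; apply: (@le_trans _ _ (expR (- L))); last by rewrite lerDr.
  apply: (@mean_lower_eps L thr N) => //.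
  have w0 : 0 < w := weight_gt0.
  have what0 : 0 <= what by lra.
  have wL : 0 <= what * L by rewrite mulr_ge0.
  have dL : 0 <= (48 * what - w) * L by rewrite mulr_ge0//; lra.
  have /nsampP/andP[+ _] : 0 <= 1536 * what * L by lra.
  by apply: le_trans; lra.
by rewrite ExD Ex_cst//; have := weight_est_high L0; rewrite -/w; lra.
Qed.

End estimation.

(** * One round of the algorithm *)

Lemma ler_sum_subseq (R : numDomainType) (I : eqType) (f : I -> R) (A A' : seq I) :
  (forall i, 0 <= f i) -> subseq A' A -> \sum_(i <- A') f i <= \sum_(i <- A) f i.
Proof.
move=> f0; elim: A A' => [|i A IH] [|j A'] //=; rewrite ?big_nil.
  by move=> _; exact: sumr_ge0.
case: eqP => [->|_] /IH; first by rewrite !big_cons lerD2l.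
by move=> H; rewrite [leRHS]big_cons (le_trans H)// lerDr.
Qed.

Fixpoint filter_prog n (A : seq 'I_n) (t : 'I_n -> prog n bool) : prog n (seq 'I_n) :=
  if A is i :: A' then
    bind (t i) (fun b => bind (filter_prog A' t) (fun s => Ret (if b then i :: s else s)))
  else Ret [::].

Section filter_prog.
Variables (R : realType) (n : nat) (pr : 'I_n -> nat -> nat -> R).
Hypothesis pr_ge0 : forall i M j, 0 <= pr i M j.
Hypothesis pr_sum : forall i M, \sum_(j < M.+1) pr i M j = 1.
Implicit Types (A : seq 'I_n) (t : 'I_n -> prog n bool).

Lemma outs_filter_prog A t (g : 'I_n -> R) :
  (forall i, outs (t i) (fun _ c => c%:R <= g i)) ->
  outs (filter_prog A t) (fun s c => subseq s A /\ c%:R <= \sum_(i <- A) g i).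
Proof.
move=> tg; elim: A => [|i A IH] /=; first by rewrite big_nil.
apply: outs_bind; apply: outs_imp (tg i) => b c cg.
apply: outs_bind; apply: outs_imp IH => s c' [sA c'g].
split; last by rewrite big_cons addn0 natrD lerD.
case: b => /=; first by rewrite eqxx.
exact: (subseq_trans sA (subseq_cons _ _)).
Qed.

Lemma outs_filter_prog_subseq A t : outs (filter_prog A t) (fun s _ => subseq s A).
Proof.
elim: A => [//|i A IH]; apply: outs_bind; apply: outsT => x _.
apply: outs_bind; apply: outs_imp IH => s _ sA; case: x => /=; first by rewrite eqxx.
exact: (subseq_trans sA (subseq_cons _ _)).
Qed.

Lemma Ex_filter_prog_sum A t (P : pred 'I_n) (f : 'I_n -> R) :
  Ex pr (filter_prog A t) (fun s _ => \sum_(i <- s | P i) f i) =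
  \sum_(i <- A | P i) f i * Ex pr (t i) (fun b _ => b%:R).
Proof.
elim: A => [|i A IH] /=; first by rewrite !big_nil.
rewrite Ex_bind big_cons -IH.
transitivity (Ex pr (t i) (fun b _ => (if P i then f i * b%:R else 0) +
  Ex pr (filter_prog A t) (fun s _ => \sum_(i <- s | P i) f i))).
  apply: eq_Ex => b c.
  rewrite Ex_bind /= -(Ex_cst pr_sum (filter_prog A t) (if P i then f i * b%:R else 0)) -ExD.
  apply: eq_Ex => s c'.
  by case: b; rewrite ?big_cons; case: ifP => _; rewrite ?mulr1 ?mulr0 ?add0r.
rewrite ExD Ex_cst//; case: ifP => _; last by rewrite Ex_cst ?add0r.
by rewrite ExZ.
Qed.

Lemma Ex_filter_prog_notin A t b : b \in A ->
  Ex pr (filter_prog A t) (fun s _ => (b \notin s)%:R) <=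
  Ex pr (t b) (fun x _ => (~~ x)%:R).
Proof.
elim: A => [//|i A IH]; rewrite inE /= Ex_bind => bA.
have [bi|bi] := eqVneq b i.
  subst i; apply: le_Ex => // x _; rewrite Ex_bind /=.
  by apply: Ex_le => // s _; case: x; rewrite ?inE ?eqxx//= lern1 leq_b1.
apply: Ex_le => // x _; rewrite Ex_bind /=.
move: bA; rewrite (negbTE bi) /= => /IH; apply: le_trans; apply: le_Ex => // s _.
by case: x; rewrite ?inE ?(negbTE bi).
Qed.

End filter_prog.

Section round.
Variables (R : realType) (n : nat) (M : nat) (eps : R).

(* Weighted median elimination: an arm whose mean is below [thr] keeps passing with
   small probability only, so retaining half of the total weight is evidence that
   some arm is above [thr]. *)
Fixpoint search (w : 'I_n -> R) (thr : R) (fuel : nat) (A : seq 'I_n) (L : R) : prog n bool :=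
  if fuel is f.+1 then
    bind (filter_prog A (fun i => trial i M eps (w i) thr L)) (fun A' =>
      if nilp A' then Ret false
      else if (\sum_(i <- A) w i) / 2 <= \sum_(i <- A') w i then Ret true
      else search w thr f A' (L + 1))
  else Ret false.

(** The default [1 / eps] is a lower bound of every estimate, so the result is a positive weighting
    of all arms. *)
Fixpoint weights (A : seq 'I_n) (L : R) : prog n ('I_n -> R) :=
  if A is i :: A' then
    bind (weight_est i M eps L) (fun x => bind (weights A' L) (fun w =>
      Ret (fun j => if j == i then x else w j)))
  else Ret (fun _ => 1 / eps).

Definition heaviest (w : 'I_n -> R) (i0 : 'I_n) (A : seq 'I_n) : 'I_n :=
  if A is i :: A' then foldl (fun a j => if w a <= w j then j else a) i A' else i0.

Lemma heaviestP w i0 A : A != [::] ->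
  heaviest w i0 A \in A /\ (forall j, j \in A -> w j <= w (heaviest w i0 A)).
Proof.
case: A => [//|i A] _ /=.
elim/last_ind: A => [|A j [IH1 IH2]].
  by rewrite mem_seq1 eqxx; split=> // j; rewrite mem_seq1 => /eqP->.
rewrite -cats1 foldl_cat /=; set a := foldl _ _ _ in IH1 IH2 *.
rewrite -cat_cons; have [aj|ja] := leP (w a) (w j).
  split; first by rewrite mem_cat mem_seq1 eqxx orbT.
  move=> k; rewrite mem_cat mem_seq1 => /orP[/IH2 ka|/eqP->//].
  exact: le_trans ka aj.
split; first by rewrite mem_cat IH1.
by move=> k; rewrite mem_cat mem_seq1 => /orP[/IH2//|/eqP->]; exact: ltW.
Qed.

(* The invariant is [l <= theta b <= l + 6 * eps] for the best arm [b]; a round divides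
   the length of this interval by 3/2. Only the heaviest survivor may be returned: once
   all other arms are far, either [b] is the heaviest and the algorithm stops, or the
   cost of [b] is charged to a heavier survivor. *)
Definition round (i0 : 'I_n) (L : R) (S : seq 'I_n) (l : R) :
    prog n (('I_n -> R) * (seq 'I_n * R + 'I_n)) :=
  bind (weights S L) (fun w =>
  bind (search w (l + 3 * eps) (size S) S L) (fun y =>
  let l' := if y then l + 2 * eps else l in
  bind (filter_prog S (fun i => trial i M eps (w i) (l' - eps) L)) (fun S' =>
  let a := heaviest w i0 S' in
  bind (search w (l' - eps) (size S) (rem a S') L) (fun z =>
  Ret (w, if z then inl (S', l') else inr a))))).

Hypothesis M0 : (0 < M)%N.
Hypothesis eps0 : 0 < eps.
Hypothesis eps1 : eps <= 1.

Variable K : R.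
Hypothesis trial_cost_le : 1543 <= K.

Let outs_trial_cost (i : 'I_n) what thr L : 1 <= L -> 1 / eps <= what ->
  outs (trial i M eps what thr L) (fun _ c => (c%:R : R) <= K * (what * L)).
Proof.
move=> L1 ew; apply: outs_imp (outs_trial i M eps0 eps1 thr L1 ew) => _ c cw.
have K1 := trial_cost_le; have e0 : 0 < 1 / eps by rewrite divr_gt0.
have wL : 0 <= what * L by apply: mulr_ge0; lra.
have K2 : 0 <= K - 1543 by lra.
by have := mulr_ge0 K2 wL; lra.
Qed.

Let K_ge0 : 0 <= K.
Proof. by have := trial_cost_le; lra. Qed.

Let weighting (w : 'I_n -> R) := forall i, 1 / eps <= w i.

Let weighting_gt0 w i : weighting w -> 0 < w i.
Proof. by move=> /(_ i); apply: lt_le_trans; rewrite divr_gt0. Qed.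

Let sum_gt0 w A : weighting w -> A != [::] -> 0 < \sum_(i <- A) w i.
Proof.
move=> ww; case: A => [//|i A] _; rewrite big_cons ltr_pwDl ?weighting_gt0//.
by apply: sumr_ge0 => j _; rewrite ltW ?weighting_gt0.
Qed.

(** The weight is more than halved at each further pass while [L] grows by 1, and the sum over k of
    (L + k) / 2^k is 2 (L + 1). *)
Lemma outs_search w thr f A L : weighting w -> 1 <= L ->
  outs (search w thr f A L)
    (fun _ c => (c%:R : R) <= 2 * (K * (\sum_(i <- A) w i * (L + 1)))).
Proof.
move=> ww; elim: f A L => [|f IH] A L L1.
  rewrite /= !mulr_ge0 ?K_ge0//; apply: sumr_ge0 => i _; rewrite mulr_ge0 ?ltW ?weighting_gt0//.
  by lra.
rewrite -mulr_suml; set W := \sum_(i <- A) w i.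
have W0 : 0 <= W by apply: sumr_ge0 => i _; rewrite ltW ?weighting_gt0.
have cF := outs_filter_prog A (fun i => outs_trial_cost i thr L1 (ww i)).
apply: outs_bind; apply: outs_imp cF => A' c [AA'].
rewrite -mulr_sumr -mulr_suml -/W => cW.
have KW : 0 <= K * W by rewrite mulr_ge0.
have KWL : 0 <= K * W * L by rewrite mulr_ge0//; lra.
case: ifP => _; first by rewrite /= addn0; lra.
case: leP => AW; first by rewrite /= addn0; lra.
have L2 : 1 <= L + 1 by lra.
apply: outs_imp (IH A' _ L2) => _ c'; rewrite -mulr_suml; set W' := \sum_(i <- A') _ in AW * => c'W.
rewrite natrD; have : 0 <= K * ((W / 2 - W') * (L + 2)).
  by rewrite mulr_ge0//; apply: mulr_ge0; lra.
lra.
Qed.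

Lemma outs_weights A L : 1 <= L ->
  outs (weights A L) (fun w c => [/\ (forall i, 1 / eps <= w i), (size A <= c)%N &
    uniq A -> (c%:R : R) <= 6 * L * \sum_(i <- A) w i]).
Proof.
move=> L1; elim: A => [|i A IH]; first by rewrite /= big_nil mulr0.
apply: outs_bind.
have H1 : outs (weight_est i M eps L) (fun _ c => (0 < c)%N).
  apply: outs_bind; have Hc : outs (sum_prog (nsamp (2 * L / eps)) (draw_sq R i M))
    (fun _ c => c = (nsamp (2 * L / eps)%R * 2)%N) by apply: outs_sum_prog => j j'.
  by apply: outs_imp Hc => s c ->.
have H2 := outs_weight_est i M eps0 eps1 L1.
apply: outs_imp (outs_and H1 H2) => x c [c0 [ex cx]].
apply: outs_bind; apply: outs_imp IH => w c' [ww sc cw] /=; split.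
- by move=> j; case: ifP.
- by rewrite addn0 -add1n leq_add.
move=> /andP[iA uA]; rewrite big_cons eqxx addn0 natrD mulrDr lerD ?cw//.
  apply: le_trans cx _; rewrite -[1 / eps]/(1 * eps^-1) mul1r in ex.
  by rewrite ler_wpM2l// mulr_ge0//; lra.
apply: le_trans (cw uA) _; rewrite le_eqVlt; apply/orP; left; apply/eqP.
congr (_ * _); apply: eq_big_seq => j jA.
by case: eqP => // ji; rewrite -ji jA in iA.
Qed.

(** With [W] the total weight and [L + 1 <= 2 * L], the weights cost [6 * L * W], each search at
    most [4 * K * L * W], the filter [K * L * W]; 13 leaves room for the 6. *)
Lemma outs_round i0 L S l : uniq S -> 1 <= L ->
  outs (round i0 L S l) (fun r c =>
    [/\ (c%:R : R) <= 13 * (K * (L * \sum_(i <- S) r.1 i)),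
        (forall i, 0 <= r.1 i) &
        if r.2 is inl (S', l') then subseq S' S /\ (0 < c)%N else True]).
Proof.
move=> uS L1; have K0 := K_ge0; have K1 := trial_cost_le.
case: S uS => [|i S] uS.
  rewrite /= big_nil !mulr0; split=> // j; by rewrite divr_ge0// ltW.
move: (i :: S) uS (isT : (0 < size (i :: S))%N) => {i}S uS S0.
apply: outs_bind; apply: outs_imp (outs_weights S L1) => w c1 [ww c10 /(_ uS) c1w].
apply: outs_bind; apply: outs_imp (outs_search _ _ _ ww L1) => y c2 c2w.
set l' := if y then _ else _.
have cF := outs_filter_prog S (fun i => outs_trial_cost i (l' - eps) L1 (ww i)).
apply: outs_bind; apply: outs_imp cF => S' c3 [SS']; rewrite -mulr_sumr -mulr_suml => c3w.
apply: outs_bind; apply: outs_imp (outs_search _ _ _ ww L1) => z c4 c4w.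
split=> [|j|] /=; first last.
- by case: z {c4w} => //; split=> //; rewrite !addn_gt0 (leq_trans S0 c10).
- by rewrite ltW ?weighting_gt0.
set W := \sum_(i <- S) w i in c1w c2w c3w *.
rewrite -mulr_suml -/W in c2w; rewrite -mulr_suml in c4w.
have W0 : 0 <= W by apply: sumr_ge0 => j _; rewrite ltW ?weighting_gt0.
have : \sum_(i <- rem (heaviest w i0 S') S') w i <= W.
  apply: ler_sum_subseq => [j|]; first by rewrite ltW ?weighting_gt0.
  exact: subseq_trans (rem_subseq _ _) SS'.
move: (\sum_(i <- rem _ _) _) c4w => W' c4w W'W.
have KW : 0 <= K * ((W - W') * (L + 1)) by rewrite mulr_ge0//; apply: mulr_ge0; lra.
have WL : 0 <= W * (L - 1) by apply: mulr_ge0; lra.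
have KWL : 0 <= K * (W * (L - 1)) by rewrite mulr_ge0.
have W1 : 0 <= W * L by apply: mulr_ge0; lra.
have KW2 := mulr_ge0 (_ : 0 <= K - 1543) W1.
have {}KW2 : 0 <= (K - 1543) * (W * L) by apply: KW2; lra.
by rewrite addn0 !natrD; lra.
Qed.

Variable pr : 'I_n -> nat -> nat -> R.
Hypothesis pr_ge0 : forall i M j, 0 <= pr i M j.
Hypothesis pr_sum : forall i M, \sum_(j < M.+1) pr i M j = 1.
Variable theta : 'I_n -> R.
Hypothesis theta_close : forall i, qmean pr i M <= theta i <= qmean pr i M + eps / 4.
Let tw i := weight pr i M eps.

Let pass_low i x thr L : 0 <= L -> theta i <= thr - eps ->
  Ex pr (trial i M eps x thr L) (fun b _ => b%:R) <= expR (- L).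
Proof.
move=> L0 it; apply: trial_pass => //.
have /andP[? ?] := theta_close i; have e0 := eps0; lra.
Qed.

Let fail_high i x thr L : 0 <= L -> thr + eps <= theta i -> tw i / 4 <= x ->
  Ex pr (trial i M eps x thr L) (fun b _ => (~~ b)%:R) <= 2 * expR (- L).
Proof.
move=> L0 it ix; apply: trial_fail => //.
have /andP[? ?] := theta_close i; have e0 := eps0; lra.
Qed.

Let expR_succ (L : R) : expR (- (L + 1)) <= expR (- L) / 2.
Proof.
rewrite opprD expRD ler_pM2l ?expR_gt0//.
rewrite expRN lef_pV2 ?posrE ?expR_gt0//.
by apply: le_trans (expR_ge1Dx 1); lra.
Qed.

(** A pass drops [b] with probability at most [2 * expR (- L)], and these errors at least halve from
    pass to pass. A pass that leads to another one has lost an arm, so fuel [size A] is enough. *)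
Lemma search_miss w thr f A L b : weighting w -> 0 <= L -> b \in A -> (size A <= f)%N ->
  thr + eps <= theta b -> tw b / 4 <= w b ->
  Ex pr (search w thr f A L) (fun y _ => (~~ y)%:R) <= 4 * expR (- L).
Proof.
move=> ww + + + bt bw; elim: f A L => [|f IH] A L L0 bA sA.
  by move: sA; rewrite leqn0 size_eq0 => /eqP AE; rewrite AE in bA.
rewrite /= Ex_bind.
have cF := outs_filter_prog_subseq A (fun i => trial i M eps (w i) thr L).
apply: (@le_trans _ _ (Ex pr (filter_prog A (fun i => trial i M eps (w i) thr L))
    (fun s _ => (b \notin s)%:R + 4 * expR (- (L + 1))))).
  apply: (le_Ex_outs pr_ge0 cF) => s _ sAs.
  have e0 : 0 <= 4 * expR (- (L + 1)) by rewrite mulr_ge0 ?expR_ge0.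
  case: ifP => [/nilP->|s0]; first by rewrite /= lerDl.
  case: (leP ((\sum_(i <- A) w i) / 2)) => sw; first by rewrite /= addr_ge0.
  have [bs|nbs] := boolP (b \in s); last first.
    apply: (@le_trans _ _ 1); last by rewrite lerDl.
    exact: Ex_bool_le1.
  rewrite add0r; apply: IH => //; first by rewrite addr_ge0.
  rewrite -ltnS (leq_trans _ sA)// ltn_neqAle size_subseq// andbT.
  apply/negP => /eqP ss; move: sw.
  have -> : s = A by apply/eqP; rewrite -(size_subseq_leqif sAs).2 ss.
  rewrite ltNge => /negP; apply.
  have : 0 < \sum_(i <- A) w i by apply: sum_gt0 => //; case: (A) bA.
  lra.
rewrite ExD Ex_cst//.
have := le_trans (Ex_filter_prog_notin pr_ge0 pr_sum (fun i => trial i M eps (w i) thr L) bA)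
   (fail_high L0 bt bw).
have := expR_succ L; lra.
Qed.

(** The expected retained weight is at most [expR (- L)] times the total, so Markov's inequality
    bounds the wrong answer of a pass by [2 * expR (- L)], independently of the number of arms. *)
Lemma search_false w thr f A L : weighting w -> 0 <= L ->
  (forall i, i \in A -> theta i <= thr - eps) ->
  Ex pr (search w thr f A L) (fun y _ => y%:R) <= 4 * expR (- L).
Proof.
move=> ww; elim: f A L => [|f IH] A L L0 At; first by rewrite mulr_ge0 ?expR_ge0.
rewrite /= Ex_bind.
have cF := outs_filter_prog_subseq A (fun i => trial i M eps (w i) thr L).
set W := \sum_(i <- A) w i.
have W0 : 0 <= W by apply: sumr_ge0 => i _; rewrite ltW ?weighting_gt0.
apply: (@le_trans _ _ (Ex pr (filter_prog A (fun i => trial i M eps (w i) thr L))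
    (fun s _ => 2 / W * \sum_(i <- s) w i + 4 * expR (- (L + 1))))).
  apply: (le_Ex_outs pr_ge0 cF) => s _ sA.
  have e0 : 0 <= 4 * expR (- (L + 1)) by rewrite mulr_ge0 ?expR_ge0.
  have s0 : 0 <= 2 / W * \sum_(i <- s) w i.
    by rewrite mulr_ge0 ?divr_ge0//; apply: sumr_ge0 => i _; rewrite ltW ?weighting_gt0.
  case: ifP => [_|/nilP sn]; first by rewrite addr_ge0.
  case: (leP (W / 2)) => sw; last first.
    rewrite -[leLHS]add0r lerD//; apply: IH => [|i /(mem_subseq sA)/At//].
    by rewrite addr_ge0.
  have Wp : 0 < W.
    by apply: sum_gt0 => //; apply/eqP => An; rewrite An subseq0 in sA; apply: sn; apply/eqP.
  rewrite /= -[leLHS]addr0 lerD// mulrAC ler_pdivlMr//; lra.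
rewrite ExD Ex_cst// ExZ (Ex_filter_prog_sum pr_sum) //.
have : \sum_(i <- A) w i * Ex pr (trial i M eps (w i) thr L) (fun b _ => b%:R) <= W * expR (- L).
  rewrite mulr_suml big_seq [leRHS]big_seq; apply: ler_sum => i iA.
  by rewrite ler_wpM2l ?pass_low ?At// ltW ?weighting_gt0.
move=> H; have e0 := expR_ge0 (- L).
apply: (@le_trans _ _ (2 * expR (- L) + 4 * expR (- (L + 1)))).
  rewrite lerD2r -mulrA ler_pM2l//.
  have [->|Wn] := eqVneq W 0; first by rewrite invr0 mul0r.
  by rewrite mulrC ler_pdivrMr ?lt_def ?Wn// mulrC.
have := expR_succ L; lra.
Qed.

Variables (b : 'I_n) (far : pred 'I_n) (B : R) (kappa : 'I_n -> R).
Hypothesis B0 : 0 <= B.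
Hypothesis kappa_ge0 : forall i, 0 <= kappa i.
Hypothesis far_theta : forall i, i != b -> far i -> theta i + 6 * eps <= theta b.
Hypothesis theta_max : forall i, i != b -> theta i <= theta b.
Hypothesis far_all : far b -> forall i, i != b -> far i.

Definition round_good (r : seq 'I_n * R + 'I_n) : bool :=
  match r with
  | inl (S', l') => (b \in S') && (l' <= theta b <= l' + 4 * eps)
  | inr a => a == b
  end.

(* [kappa i] is what the survival of arm [i] costs later, [B] the cost of a failure. *)
Definition round_loss (r : seq 'I_n * R + 'I_n) : R :=
  if round_good r then if r is inl (S', _) then \sum_(i <- S') kappa i else 0
  else B.

Let low w : R := (w b < tw b / 4)%R%:R.

Let low_ge0 w : 0 <= low w.
Proof. exact: ler0n. Qed.

Let tw_gt0 i : 0 < tw i.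
Proof. exact: weight_gt0. Qed.

Section final_search.
Variables (i0 : 'I_n) (L : R) (w : 'I_n -> R) (S : seq 'I_n).
Hypotheses (L0 : 0 <= L) (ww : weighting w) (uS : uniq S).
Let q := expR (- L).

Let q0 : 0 <= q. Proof. exact: expR_ge0. Qed.

(** If [a] is [b] and [b] is far, only far arms are tested and the algorithm most likely stops. If
    [a] is another arm, [b] is tested and most likely survives; then [tw b / 4 <= w b <= w a], so 1
    is at most [4 / tw b] times the weight of the other survivors, and [kappa b] is charged to them.
    An underestimate of [b], the event [low w], is paid in full. *)
Lemma final_search_le S' l' (a := heaviest w i0 S') : subseq S' S -> l' <= theta b <= l' + 4 * eps ->
  Ex pr (search w (l' - eps) (size S) (rem a S') L)
    (fun z _ => round_loss (if z then inl (S', l') else inr a)) <=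
  B * (b \notin S')%:R + (B * (low w + 4 * q) + (\sum_(i <- S' | i != b) kappa i +
  kappa b * (if far b then low w + 4 * q + 4 / tw b * \sum_(i <- S' | i != b) w i else 1))).
Proof.
move=> SS' bl; have uS' := subseq_uniq SS' uS; have lw := low_ge0 w.
have q4 : 0 <= 4 * q by rewrite mulr_ge0.
have K0 : 0 <= \sum_(i <- S' | i != b) kappa i by apply: sumr_ge0.
have W0 : 0 <= \sum_(i <- S' | i != b) w i.
  by apply: sumr_ge0 => i _; rewrite ltW ?weighting_gt0.
have tW0 : 0 <= 4 / tw b * \sum_(i <- S' | i != b) w i by rewrite mulr_ge0// divr_ge0// ltW.
have k0 : 0 <= kappa b * (if far b then low w + 4 * q + 4 / tw b * \sum_(i <- S' | i != b) w i else 1).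
  by rewrite mulr_ge0//; case: (far b); rewrite // addr_ge0// addr_ge0.
have B1 : 0 <= B * (low w + 4 * q) by rewrite mulr_ge0// addr_ge0.
have [bS'|nbS'] := boolP (b \in S'); last first.
  rewrite mulr1; apply: (@le_trans _ _ B); last by rewrite lerDl !addr_ge0.
  apply: Ex_le => // z _; rewrite /round_loss; case: z => /=; first by rewrite (negbTE nbS').
  by case: ifP.
have S'0 : S' != [::] by case: (S') bS'.
have [aS' amax] := heaviestP w i0 S'0; rewrite -/a in aS' amax.
have sumS' : \sum_(i <- S') kappa i = kappa b + \sum_(i <- S' | i != b) kappa i.
  by rewrite (bigD1_seq b).
rewrite mulr0 add0r.
have [ab|ab] := eqVneq a b.
  apply: (@le_trans _ _ (Ex pr (search w (l' - eps) (size S) (rem a S') L) (fun z _ =>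
     \sum_(i <- S' | i != b) kappa i + kappa b * z%:R))).
    apply: le_Ex => // -[] _; rewrite /round_loss /=.
      by rewrite bS' bl /= sumS' mulr1 addrC.
    by rewrite ab eqxx mulr0 addr0.
  rewrite ExD Ex_cst// ExZ -[leLHS]add0r lerD// lerD2l ler_wpM2l//.
  case: ifPn => [fb|_]; last exact: Ex_bool_le1.
  apply: le_trans (search_false _ ww L0 _) _; last first.
    by rewrite -addrA addrC -addrA lerDl addr_ge0.
  move=> i; rewrite mem_rem_uniq// inE ab => /andP[ib iS'].
  have := far_theta ib (far_all fb ib); move/andP: bl; have := eps0; lra.
have wb_wa : w b <= w a by exact: amax.
apply: (@le_trans _ _ (Ex pr (search w (l' - eps) (size S) (rem a S') L) (fun z _ =>
   B * (~~ z)%:R + (\sum_(i <- S' | i != b) kappa i + kappa b)))).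
  apply: le_Ex => // -[] _; rewrite /round_loss /=.
    by rewrite bS' bl /= sumS' mulr0 add0r addrC.
  by rewrite (negbTE ab) mulr1 lerDl addr_ge0.
rewrite ExD Ex_cst// ExZ.
have [lo|hi] := ltP (w b) (tw b / 4).
  have l1 : low w = 1 by rewrite /low lo.
  rewrite l1 lerD//.
    rewrite ler_wpM2l//; apply: (@le_trans _ _ 1); last by rewrite lerDl mulr_ge0.
    exact: Ex_bool_le1.
  rewrite lerD2l -[leLHS]mulr1 ler_wpM2l//; case: ifP => // _.
  by rewrite -addrA lerDl addr_ge0.
have l1 : low w = 0 by rewrite /low ltNge hi.
rewrite l1 add0r lerD//.
  rewrite ler_wpM2l//; apply: (search_miss (b := b)) => //.
  - by rewrite mem_rem_uniq// inE bS' eq_sym ab.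
  - by rewrite (leq_trans _ (size_subseq SS'))// size_subseq// rem_subseq.
  - by move/andP: bl; lra.
rewrite lerD2l -[leLHS]mulr1 ler_wpM2l//; case: ifP => // _.
apply: (@le_trans _ _ (4 / tw b * \sum_(i <- S' | i != b) w i)); last first.
  by rewrite lerDr mulr_ge0.
rewrite mulrAC ler_pdivlMr// mul1r.
have : w a <= \sum_(i <- S' | i != b) w i.
  rewrite -big_filter (bigD1_seq a) ?mem_filter ?filter_uniq ?ab//= lerDl; apply: sumr_ge0 => i _.
  by rewrite ltW ?weighting_gt0.
lra.
Qed.

(** A far arm has mean at most [l' - 2 * eps], because [theta b <= l' + 4 * eps]. It passes the
    threshold [l' - eps] with probability at most [q], whatever its estimated weight. *)
Lemma after_first_search_le l' : b \in S -> l' <= theta b <= l' + 4 * eps ->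
  Ex pr (filter_prog S (fun i => trial i M eps (w i) (l' - eps) L)) (fun S' _ =>
    B * (b \notin S')%:R + (B * (low w + 4 * q) + (\sum_(i <- S' | i != b) kappa i +
    kappa b * (if far b then low w + 4 * q + 4 / tw b * \sum_(i <- S' | i != b) w i else 1)))) <=
  B * (2 * low w + 6 * q) + (\sum_(i <- S | i != b) kappa i * (if far i then q else 1) +
    kappa b * (if far b then low w + 4 * q + 4 / tw b * \sum_(i <- S | i != b) w i * q else 1)).
Proof.
move=> bS bl; set t := fun i => trial _ _ _ _ _ _.
have pass i : i != b -> Ex pr (t i) (fun x _ => x%:R) <= if far i then q else 1.
  move=> ib; case: ifPn => fi; last exact: Ex_bool_le1.
  apply: pass_low => //; have := far_theta ib fi; move/andP: bl; lra.
have E1 : Ex pr (filter_prog S t) (fun S' _ => (b \notin S')%:R) <= low w + 2 * q.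
  apply: le_trans (Ex_filter_prog_notin pr_ge0 pr_sum t bS) _; rewrite /low.
  have [lo|hi] := ltP (w b) (tw b / 4).
    apply: (@le_trans _ _ 1); last by rewrite lerDl mulr_ge0.
    exact: Ex_bool_le1.
  by rewrite add0r; apply: fail_high => //; move/andP: bl; lra.
have E2 : Ex pr (filter_prog S t) (fun S' _ => \sum_(i <- S' | i != b) kappa i) <=
    \sum_(i <- S | i != b) kappa i * (if far i then q else 1).
  rewrite (Ex_filter_prog_sum pr_sum); apply: ler_sum => i ib.
  by rewrite ler_wpM2l// pass.
have E3 : far b -> Ex pr (filter_prog S t) (fun S' _ => \sum_(i <- S' | i != b) w i) <=
    \sum_(i <- S | i != b) w i * q.
  move=> fb; rewrite (Ex_filter_prog_sum pr_sum); apply: ler_sum => i ib.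
  by rewrite ler_wpM2l ?(ltW (weighting_gt0 _ ww))//; have := pass i ib; rewrite (far_all fb ib).
rewrite ExD ExZ ExD Ex_cst// ExD ExZ addrA lerD//.
  rewrite -mulrDr ler_wpM2l//; lra.
rewrite lerD// ler_wpM2l//; case: ifP => [fb|_]; last by rewrite Ex_cst.
by rewrite ExD Ex_cst// ExZ lerD2l ler_wpM2l ?E3// divr_ge0// ltW.
Qed.

Lemma after_weights_le l : b \in S -> l <= theta b <= l + 6 * eps ->
  Ex pr (bind (search w (l + 3 * eps) (size S) S L) (fun y =>
    let l' := if y then l + 2 * eps else l in
    bind (filter_prog S (fun i => trial i M eps (w i) (l' - eps) L)) (fun S' =>
    let a := heaviest w i0 S' in
    bind (search w (l' - eps) (size S) (rem a S') L) (fun z =>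
    Ret (w, if z then inl (S', l') else inr a))))) (fun r _ => round_loss r.2) <=
  B * (3 * low w + 10 * q) + (\sum_(i <- S | i != b) kappa i * (if far i then q else 1) +
    kappa b * (if far b then low w + 4 * q + 4 / tw b * \sum_(i <- S | i != b) w i * q else 1)).
Proof.
move=> bS bl; rewrite Ex_bind; set Z := _ + kappa b * _.
have lw := low_ge0 w.
have Z0 : 0 <= Z.
  apply: addr_ge0.
    by apply: sumr_ge0 => i _; rewrite mulr_ge0//; case: ifP.
  rewrite mulr_ge0//; case: ifP => // _.
  rewrite !addr_ge0 ?mulr_ge0 ?invr_ge0 ?(ltW (tw_gt0 b))//; apply: sumr_ge0 => i _.
  by rewrite mulr_ge0// ltW ?weighting_gt0.
pose l' (y : bool) := if y then l + 2 * eps else l.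
(* The search is unreliable only when [theta b] is within [eps] of the threshold [l + 3 * eps], and
   there both answers leave a correct interval. *)
pose wrong y := ~~ (l' y <= theta b <= l' y + 4 * eps).
apply: (@le_trans _ _ (Ex pr (search w (l + 3 * eps) (size S) S L) (fun y _ =>
    B * (wrong y)%:R + (B * (2 * low w + 6 * q) + Z)))).
  apply: le_Ex => // y _; rewrite -/(l' y) /wrong.
  have [ok|nok] := boolP (l' y <= theta b <= l' y + 4 * eps); last first.
    rewrite mulr1; apply: (@le_trans _ _ B); last first.
      by rewrite lerDl addr_ge0// mulr_ge0// addr_ge0 ?mulr_ge0.
    rewrite Ex_bind; apply: Ex_le => // S' _; rewrite Ex_bind; apply: Ex_le => // z _.
    rewrite /= /round_loss; case: z => /=; first by rewrite (negbTE nok) andbF.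
    by case: ifP.
  rewrite mulr0 add0r; apply: le_trans (after_first_search_le bS ok); rewrite Ex_bind.
  apply: (le_Ex_outs pr_ge0 (outs_filter_prog_subseq _ _)) => S' _ SS'; rewrite Ex_bind /=; exact: final_search_le.
rewrite ExD Ex_cst// ExZ addrA lerD2r.
have : Ex pr (search w (l + 3 * eps) (size S) S L) (fun y _ => (wrong y)%:R) <= low w + 4 * q.
  have [hi|nhi] := ltP (l + 4 * eps) (theta b).
    apply: (@le_trans _ _ (Ex pr (search w (l + 3 * eps) (size S) S L) (fun y _ => (~~ y)%:R))).
      apply: le_Ex => // y _; rewrite /wrong /l'; case: y => /=; last by rewrite lern1 leq_b1.
      rewrite lern0 eqb0 negbK; move/andP: bl => [? ?]; apply/andP; split; have := eps0; lra.
    rewrite /low; have [lo|hib] := ltP (w b) (tw b / 4).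
      apply: (@le_trans _ _ 1); last by rewrite lerDl mulr_ge0.
      exact: Ex_bool_le1.
    by rewrite add0r; apply: (search_miss (b := b)) => //; lra.
  have [lo|nlo] := ltP (theta b) (l + 2 * eps).
    apply: (@le_trans _ _ (Ex pr (search w (l + 3 * eps) (size S) S L) (fun y _ => y%:R))).
      apply: le_Ex => // y _; rewrite /wrong /l'; case: y => /=; first by rewrite lern1 leq_b1.
      by rewrite lern0 eqb0 negbK; move/andP: bl => [-> _].
    apply: le_trans (search_false _ ww L0 _) _; last by rewrite lerDr.
    move=> i iS; have [->|ib] := eqVneq i b; first by lra.
    have := theta_max ib; lra.
  apply: Ex_le => // y _; apply: (@le_trans _ _ 0); last by rewrite addr_ge0 ?mulr_ge0.
  rewrite /wrong lern0 eqb0 negbK /l'; move/andP: bl => [? ?].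
  by case: y; apply/andP; split; have := eps0; lra.
move=> H; have := ler_wpM2l B0 H; lra.
Qed.

End final_search.

Let weights_cons i A L : weights (i :: A) L =
  bind (weight_est i M eps L) (fun x => bind (weights A L) (fun w =>
    Ret (fun j => if j == i then x else w j))).
Proof. by []. Qed.

Lemma Ex_weights S L i (f : R -> R) : uniq S -> i \in S ->
  Ex pr (weights S L) (fun w _ => f (w i)) = Ex pr (weight_est i M eps L) (fun x _ => f x).
Proof.
elim: S => [//|j S IH] /andP[jS uS]; rewrite inE weights_cons Ex_bind => ijS.
have [->|ij] := eqVneq i j.
  apply: eq_Ex => x c; rewrite Ex_bind -[RHS](Ex_cst pr_sum (weights S L)).
  by apply: eq_Ex => w c'; rewrite /= eqxx.
move: ijS; rewrite (negbTE ij) orFb => iS.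
transitivity (Ex pr (weights S L) (fun w _ => f (w i))); last exact: IH.
rewrite -[RHS](Ex_cst pr_sum (weight_est j M eps L)).
apply: eq_Ex => x c; rewrite Ex_bind.
by apply: eq_Ex => w c'; rewrite /= (negbTE ij).
Qed.

(** On every branch the samples of a round are bounded in terms of its estimated weights, so its
    expected cost requires only the law of the weighting phase. *)
Lemma Ex_round_weights i0 L S l (F : ('I_n -> R) -> R) :
  Ex pr (round i0 L S l) (fun r _ => F r.1) = Ex pr (weights S L) (fun w _ => F w).
Proof.
rewrite Ex_bind; apply: eq_Ex => w c.
rewrite Ex_bind -[RHS](Ex_cst pr_sum (search w (l + 3 * eps) (size S) S L)).
apply: eq_Ex => y c2; set l' := if y then _ else _.
rewrite Ex_bind -[LHS]/(Ex pr _ _) -[RHS](Ex_cst pr_sum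
  (filter_prog S (fun i => trial i M eps (w i) (l' - eps) L))).
apply: eq_Ex => S' c3.
rewrite Ex_bind -[RHS](Ex_cst pr_sum
  (search w (l' - eps) (size S) (rem (heaviest w i0 S') S') L)).
by [].
Qed.

(** 13 is 3 for the places where an underestimate of [b] is paid, plus 4 + 2 + 4 for the two
    searches and the filter. Unbiasedness of [weight_est] turns the charged weights [w i] into
    [tw i]. *)
Lemma Ex_round_loss i0 L S l (q := expR (- L)) :
  0 <= L -> uniq S -> b \in S -> l <= theta b <= l + 6 * eps -> 1 <= L ->
  Ex pr (round i0 L S l) (fun r _ => round_loss r.2) <=
  13 * q * B + (\sum_(i <- S | i != b) kappa i * (if far i then q else 1) +
    kappa b * (if far b then 5 * q + 4 * q / tw b * \sum_(i <- S | i != b) tw i else 1)).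
Proof.
move=> L0 uS bS bl L1; rewrite /round Ex_bind.
set Z := \sum_(i <- S | i != b) kappa i * _.
apply: (@le_trans _ _ (Ex pr (weights S L) (fun w _ =>
  B * (3 * low w + 10 * q) + (Z +
    kappa b * (if far b then low w + 4 * q + 4 / tw b * \sum_(i <- S | i != b) w i * q else 1))))).
  apply: (le_Ex_outs pr_ge0 (outs_weights S L1)) => w _ [ww _ _].
  exact: (after_weights_le _ L0 ww uS bS bl).
have Elow : Ex pr (weights S L) (fun w _ => low w) <= q.
  rewrite /low (Ex_weights L (fun x => (x < tw b / 4)%R%:R) uS bS).
  exact: weight_est_low.
rewrite ExD ExZ ExD ExZ Ex_cst// ExD Ex_cst// ExZ lerD//.
  by have := ler_wpM2l B0 Elow; lra.
rewrite lerD2l ler_wpM2l//; case: ifP => [fb|_]; last by rewrite Ex_cst.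
rewrite ExD ExD Ex_cst// ExZ lerD//; first by lra.
have -> : Ex pr (weights S L) (fun w _ => \sum_(i <- S | i != b) w i * q) =
    q * \sum_(i <- S | i != b) tw i.
  rewrite -big_filter mulr_sumr.
  transitivity (\sum_(i <- [seq i <- S | i != b]) Ex pr (weights S L) (fun w _ => w i * q)).
    by rewrite -Ex_sum; apply: eq_Ex => w c; rewrite big_filter.
  apply: eq_big_seq => i; rewrite mem_filter => /andP[ib iS].
  rewrite (Ex_weights L (fun x => x * q) uS iS) /tw -(Ex_weight_est pr_sum i M eps L) -ExZ.
  by apply: eq_Ex => x c; rewrite mulrC.
by rewrite le_eqVlt; apply/orP; left; apply/eqP; ring.
Qed.

End round.

(** * The rounds and their total cost *)

Section schedule.
Variables (R : realType) (c0 delta : R).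

Definition accuracy (r : nat) : R := (2 / 3) ^+ r / 6.
(** An integer above [4 / accuracy r], that is 24 (3/2)^r, so that rounding shifts a mean by at most
    [accuracy r / 4]. *)
Definition resolution (r : nat) : nat := (24 * 2 ^ r)%N.
(** The last term makes the errors summable over the rounds; at the scale of an arm it becomes the
    [LL] term of the bound. *)
Definition confidence (r : nat) : R := c0 + ln delta^-1 + 2 * ln r.+2%:R.

Lemma accuracy_gt0 r : 0 < accuracy r.
Proof. by rewrite divr_gt0// exprn_gt0// divr_gt0. Qed.

Lemma accuracy_le r : accuracy r <= 1 / 6.
Proof. by rewrite /accuracy ler_pM2r// exprn_ile1//; lra. Qed.

Lemma accuracyS r : 6 * accuracy r.+1 = 4 * accuracy r.
Proof. by rewrite /accuracy exprS; field. Qed.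

Lemma resolution_gt0 r : (0 < resolution r)%N.
Proof. by rewrite muln_gt0 expn_gt0. Qed.

Lemma resolution_accuracy r : (resolution r)%:R^-1 <= accuracy r / 4.
Proof.
rewrite /resolution natrM natrX invfM -exprVn /accuracy.
have : (2^-1 : R) ^+ r <= (2 / 3) ^+ r by apply: lerXn2r; rewrite ?nnegrE; lra.
lra.
Qed.

Hypothesis c01 : 1 <= c0.
Hypothesis delta0 : 0 < delta.
Hypothesis delta1 : delta <= 1 / 2.

Lemma ln_inv_delta_ge0 : 0 <= ln delta^-1.
Proof. by rewrite ln_ge0// -div1r ler_pdivlMr// mul1r; have := delta1; lra. Qed.

Lemma confidence_ge1 r : 1 <= confidence r.
Proof.
have l1 := ln_inv_delta_ge0; have c1 := c01.
have : 0 <= ln (r.+2%:R : R) by rewrite ln_ge0// ler1n.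
rewrite /confidence; lra.
Qed.

Lemma confidence_le r k : (r <= k)%N -> confidence r <= confidence k.
Proof.
move=> rk; rewrite /confidence lerD2l ler_pM2l// ler_ln ?posrE ?ltr0n//.
by rewrite ler_nat !ltnS.
Qed.

Lemma confidenceS r : confidence r.+1 <= 2 * confidence r.
Proof.
have l1 := ln_inv_delta_ge0; have c1 := c01.
have : ln (r.+3%:R : R) <= 2 * ln r.+2%:R.
  have -> : 2 * ln (r.+2%:R : R) = ln (r.+2%:R ^+ 2).
    by rewrite lnXn ?ltr0n// mulr_natl.
  rewrite ler_ln ?posrE ?exprn_gt0 ?ltr0n// -natrX ler_nat.
  lia.
rewrite /confidence; lra.
Qed.

Lemma expR_confidence r : expR (- confidence r) = expR (- c0) * delta / r.+2%:R ^+ 2.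
Proof.
rewrite /confidence !opprD !expRD; congr (_ * _ * _).
  by rewrite expRN lnK ?posrE ?invr_gt0// invrK.
by rewrite expRN; congr (_^-1); rewrite expRM_natl lnK ?posrE ?ltr0n.
Qed.

End schedule.

Section loop.
Variables (R : realType) (n : nat) (i0 : 'I_n) (c0 delta : R).
Hypothesis c01 : 1 <= c0.
Hypothesis delta0 : 0 < delta.
Hypothesis delta1 : delta <= 1 / 2.
Let eps := accuracy R.
Let M := resolution.
Let Lam := confidence c0 delta.

Let eps0 r : 0 < eps r := accuracy_gt0 R r.

Let eps1 r : eps r <= 1.
Proof. by apply: le_trans (accuracy_le R r) _; lra. Qed.

Let Lam1 r : 1 <= Lam r := confidence_ge1 c01 delta0 delta1 r.

Fixpoint rounds (F r : nat) (S : seq 'I_n) (l : R) : prog n (option 'I_n) :=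
  if F is F'.+1 then
    bind (round (M r) (eps r) i0 (Lam r) S l) (fun x =>
      match x.2 with
      | inl (S', l') => rounds F' r.+1 S' l'
      | inr a => Ret (Some a)
      end)
  else Ret None.

Lemma refines_rounds F F' r S l : (F <= F')%N -> refines (rounds F r S l) (rounds F' r S l).
Proof.
elim: F F' r S l => [|F IH] [|F'] r S l //=; try by constructor.
by move=> FF'; apply: refines_bind => -[w [[S' l']|a]] /=; [exact: IH|exact: refines_refl].
Qed.

Lemma outs_rounds_none F r S l : uniq S ->
  outs (rounds F r S l) (fun o c => o = None -> (F <= c)%N).
Proof.
elim: F r S l => [//|F IH] r S l uS; apply: outs_bind.
apply: outs_imp (outs_round (M r) (eps0 r) (eps1 r) (lexx 1543) i0 l uS (Lam1 r)).
move=> [w [[S' l']|a]] c [_ _] //= [S'S c0']; have uS' := subseq_uniq S'S uS.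
apply: outs_imp (IH _ _ _ uS') => o c' Fc /Fc Fc'.
by rewrite -add1n leq_add.
Qed.

Variable K : R.
Hypothesis K_ge : 1543 <= K.
Let Cc := 13 * K.
Hypothesis c0_large : 181 * Cc * expR (- c0) <= 1 / 2.

Variable pr : 'I_n -> nat -> nat -> R.
Hypothesis pr_ge0 : forall i M j, 0 <= pr i M j.
Hypothesis pr_sum : forall i M, \sum_(j < M.+1) pr i M j = 1.
Variables (theta : 'I_n -> R) (b : 'I_n) (s : 'I_n -> nat).
Hypothesis theta_close : forall r i, qmean pr i (M r) <= theta i <= qmean pr i (M r) + eps r / 4.
Hypothesis theta_max : forall i, i != b -> theta i <= theta b.
Hypothesis theta_far : forall r i, i != b -> (s i <= r)%N -> theta i + 6 * eps r <= theta b.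
Hypothesis s_max : forall i, (s i <= s b)%N.

Let tw i r := weight pr i (M r) (eps r).
Hypothesis tw_growth : forall i r, tw i r.+1 <= 9 * tw i r.

Let T i r := Lam r * tw i r.
Let q r := expR (- Lam r).
(* The samples of arm [i] up to its scale [s i] are covered by [det], within the budget;
   [kappa] bounds the expected number of samples in excess of it. *)
Let det i r := \sum_(r <= k < (s i).+1) 3 * (Cc * T i k).
Let kappa i r := if (r <= s i)%N then 181 * (Cc * \sum_(r <= k < (s i).+1) q k * T i k)
  else 2 * (Cc * T i r).

Let Cc0 : 0 < Cc.
Proof. by rewrite /Cc; have := K_ge; lra. Qed.

Let tw0 i r : 0 < tw i r.
Proof. exact: weight_gt0. Qed.

Let T0 i r : 0 < T i r.
Proof. by rewrite mulr_gt0// (lt_le_trans _ (Lam1 r)). Qed.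

Let q0 r : 0 < q r.
Proof. exact: expR_gt0. Qed.

Let TS i r : T i r.+1 <= 18 * T i r.
Proof.
have -> : 18 * T i r = (2 * Lam r) * (9 * tw i r) by rewrite /T; ring.
rewrite ler_pM ?(ltW (tw0 _ _))//; first by apply: le_trans (Lam1 _).
exact: confidenceS.
Qed.

Let detS i r : det i r = (if (r <= s i)%N then 3 * (Cc * T i r) else 0) + det i r.+1.
Proof.
rewrite /det; case: leqP => rs; first by rewrite big_ltn.
by rewrite !big_geq ?addr0// leqW.
Qed.

Let det_ge0 i r : 0 <= det i r.
Proof.
apply: sumr_ge0 => k _; rewrite mulr_ge0// mulr_ge0 ?(ltW Cc0)//.
exact: ltW.
Qed.

Let kappa_ge0 i r : 0 <= kappa i r.
Proof.
rewrite /kappa; case: ifP => _; rewrite mulr_ge0// mulr_ge0 ?(ltW Cc0) ?(ltW (T0 _ _))//.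
by apply: sumr_ge0 => k _; rewrite mulr_ge0 ?(ltW (T0 _ _)) ?(ltW (q0 _)).
Qed.

Let q_small r : 180 * q r <= 1.
Proof.
have qe : q r <= expR (- c0).
  rewrite ler_expR lerN2 /Lam /confidence.
  have l1 := ln_inv_delta_ge0 delta0 delta1.
  have : 0 <= ln (r.+2%:R : R) by rewrite ln_ge0// ler1n.
  lra.
have C1 : 1 <= Cc by rewrite /Cc; have := K_ge; lra.
have := ler_wpM2r (expR_ge0 (- c0)) C1; have := c0_large.
lra.
Qed.

Let kappa_le i r : (r <= s i)%N -> kappa i r = 181 * (Cc * (q r * T i r)) +
  (if (r < s i)%N then kappa i r.+1 else 0).
Proof.
move=> rs; rewrite /kappa rs big_ltn ?ltnS//; case: ltnP => rs'; first by ring.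
by rewrite big_geq// addr0 addr0.
Qed.

(** In [kappa], the factor 2 past the scale is one unit for the round itself and one in reserve for
    later rounds; with the growth 18 of [T] it gives 36. *)
Let kappa_late i r : (s i <= r)%N -> kappa i r.+1 <= 36 * (Cc * T i r).
Proof.
move=> sr; rewrite /kappa leqNgt ltnS sr /=.
by have := ler_wpM2l (ltW Cc0) (TS i r); lra.
Qed.

Let cost i r := if (r <= s i)%N then Cc * (q r * T i r) else Cc * T i r.

(* Used with [m = 180], that is 36 for the survival of [i] and 144 for the overshoot of
   [b] charged to it, or 5 * 36 for [b] itself. *)
Let kappa_step i r (m : R) : 0 <= m <= 180 ->
  cost i r + (if (s i <= r)%N then m * (q r * (Cc * T i r)) else kappa i r.+1) <= kappa i r.
Proof.
move=> /andP[m0 m1]; have CT : 0 <= Cc * T i r by rewrite mulr_ge0 ?ltW.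
have qCT : 0 <= q r * (Cc * T i r) by rewrite mulr_ge0 ?(ltW (q0 r)).
have mq : m * (q r * (Cc * T i r)) <= 180 * (q r * (Cc * T i r)) by rewrite ler_wpM2r.
have q1 : 180 * q r * (Cc * T i r) <= 1 * (Cc * T i r) by rewrite ler_wpM2r.
(* Of the 181 units in [kappa], one pays the expected excess over [det], and at the scale itself the
   other 180 pay for a possible survival. Past the scale, [180 * q r <= 1] lets the reserved unit
   pay for it. *)
rewrite /cost; case: ltngtP => rs /=.
- by rewrite (kappa_le (ltnW rs)) rs; lra.
- by rewrite /kappa leqNgt rs /=; lra.
- by have := kappa_le (eq_leq rs); rewrite -rs ltnn; lra.
Qed.

(** Once [b] is past its scale, so are all other arms. Then [kappa b r.+1] is at most a multiple of
    [tw b r], which cancels the division by [tw b r]: however heavy [b] is, each other arm receives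
    a charge proportional to its own weight. *)
Lemma potential_step r S : uniq S -> b \in S ->
  \sum_(i <- S) cost i r + (\sum_(i <- S | i != b) kappa i r.+1 * (if (s i <= r)%N then q r else 1) +
  kappa b r.+1 * (if (s b <= r)%N then 5 * q r + 4 * q r / tw b r * \sum_(i <- S | i != b) tw i r
    else 1)) <= \sum_(i <- S) kappa i r.
Proof.
move=> uS bS; rewrite !(bigD1_seq b bS uS)/=.
pose charge i := if (s b <= r)%N then 144 * (q r * (Cc * T i r)) else 0.
have others i : i != b ->
    cost i r + kappa i r.+1 * (if (s i <= r)%N then q r else 1) + charge i <= kappa i r.
  move=> ib; have sib := s_max i.
  have [sb|sb] := leqP (s b) r; rewrite /charge; last first.
    rewrite (ltn_geF sb) addr0; case: ifPn => si.
      apply: le_trans (@kappa_step i r 36 _); rewrite ?si ?lerD2l//; last by apply/andP; split; lra.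
      by have := ler_wpM2l (ltW (q0 r)) (kappa_late si); lra.
    rewrite mulr1; have := @kappa_step i r 36; rewrite (negbTE si); apply => //.
    by apply/andP; split; lra.
  rewrite sb (leq_trans sib sb).
  apply: le_trans (@kappa_step i r 180 _); last by apply/andP; split; lra.
  rewrite (leq_trans sib sb) -addrA lerD2l.
  by have := ler_wpM2l (ltW (q0 r)) (kappa_late (leq_trans sib sb)); lra.
have bcase : cost b r + kappa b r.+1 * (if (s b <= r)%N then 5 * q r + 4 * q r / tw b r * \sum_(i <- S | i != b) tw i r
    else 1) <= kappa b r + \sum_(i <- S | i != b) charge i.
  rewrite /charge; case: ifPn => sb; last first.
    rewrite big1// addr0 mulr1; have := @kappa_step b r 36; rewrite (negbTE sb); apply => //.
    by apply/andP; split; lra.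
  rewrite mulrDr addrA lerD//.
    apply: le_trans (@kappa_step b r 180 _); last by apply/andP; split; lra.
    rewrite sb lerD2l.
    by have := ler_wpM2l (ltW (q0 r)) (kappa_late sb); lra.
  rewrite -mulr_sumr; set W := \sum_(i <- S | i != b) tw i r.
  have W0 : 0 <= W by apply: sumr_ge0 => i _; exact: ltW.
  have -> : \sum_(i <- S | i != b) q r * (Cc * T i r) = q r * (Cc * Lam r) * W.
    by rewrite mulr_sumr; apply: eq_bigr => i _; rewrite /T; ring.
  have c1 : 0 <= 4 * q r / tw b r * W by rewrite !mulr_ge0 ?invr_ge0 ?(ltW (q0 r)) ?(ltW (tw0 b r)).
  apply: le_trans (ler_wpM2r c1 (kappa_late sb)) _.
  rewrite le_eqVlt; apply/orP; left; apply/eqP; rewrite /T.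
  by field; rewrite gt_eqF.
have H := ler_sum S others; rewrite !big_split /= in H.
move: bcase H; move: (kappa b r.+1 * _) (\sum_(i <- S | i != b) cost i r)
  (\sum_(i <- S | i != b) (kappa i r.+1 * _)) (\sum_(i <- S | i != b) charge i)
  (\sum_(i <- S | i != b) kappa i r) (cost b r) (kappa b r) => x1 x2 x3 x4 x5 x6 x7; lra.
Qed.

Let far r : pred 'I_n := fun i => (s i <= r)%N.

Let loss B r := round_loss (eps r) theta b B (fun i => kappa i r.+1).

Variable B : R.
Hypothesis B0 : 0 < B.

Let excess r (w : 'I_n -> R) i :=
  Cc * (Lam r * (if (r <= s i)%N then Num.max 0 (w i - 3 * tw i r) else w i)).

Let Ex_excess r S l : uniq S -> b \in S ->
  Ex pr (round (M r) (eps r) i0 (Lam r) S l) (fun x _ => \sum_(i <- S) excess r x.1 i) <=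
  \sum_(i <- S) cost i r.
Proof.
move=> uS bS.
rewrite (Ex_round_weights _ _ pr_sum _ _ _ _ (fun w => \sum_(i <- S) excess r w i)).
rewrite Ex_sum big_seq [leRHS]big_seq; apply: ler_sum => i iS.
pose f x := Cc * (Lam r * (if (r <= s i)%N then Num.max 0 (x - 3 * tw i r) else x)).
rewrite (Ex_weights _ _ pr_sum _ f uS iS) /f ExZ ExZ /cost.
have L0 : 0 < Lam r by apply: lt_le_trans (Lam1 r).
case: ifP => _; last by rewrite Ex_weight_est// /T.
rewrite ler_pM2l// /T mulrCA ler_pM2l//.
by apply: weight_est_excess => //; [exact: resolution_gt0|have := Lam1 r; lra].
Qed.

Definition bad (N : R) (o : option 'I_n) (c : nat) : bool :=
  (if o is Some a then a != b else false) || (N < c%:R).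

(** [y] is the excess still allowed; each round lowers it by its own excess, and once it is negative
    the right-hand side exceeds [B] and the bound is trivial. [alpha r] majorizes the remaining
    failure probabilities by telescoping, as 1/(r+1) - 1/(r+2) >= 1/(r+2)^2. *)
Lemma Ex_rounds F r S l y (alpha := fun r => 13 * (expR (- c0) * delta) / r.+1%:R) :
  uniq S -> b \in S -> l <= theta b <= l + 6 * eps r -> y <= B ->
  B * Ex pr (rounds F r S l) (fun o c => (bad (\sum_(i <- S) det i r + y) o c)%:R) <=
  B * alpha r + (\sum_(i <- S) kappa i r + (B - y)).
Proof.
have alpha0 k : 0 <= alpha k.
  by rewrite /alpha divr_ge0// !mulr_ge0 ?expR_ge0// ltW.
have Bal k : 0 <= B * alpha k by rewrite mulr_ge0// ltW.
have det_sum0 k (A : seq 'I_n) : 0 <= \sum_(i <- A) det i k by apply: sumr_ge0.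
have kap_sum0 k (A : seq 'I_n) : 0 <= \sum_(i <- A) kappa i k by apply: sumr_ge0.
elim: F r S l y => [|F IH] r S l y uS bS bl yB.
  have := det_sum0 r S; have := kap_sum0 r S; have := Bal r.
  by rewrite /= /bad /=; case: ltP => y0; rewrite ?mulr1 ?mulr0; lra.
have alphaS : alpha r.+1 + 13 * q r <= alpha r.
  rewrite /alpha /q expR_confidence//.
  set e := expR (- c0) * delta.
  have e0 : 0 <= e by rewrite mulr_ge0 ?expR_ge0// ltW.
  have -> : 13 * e / r.+1%:R = 13 * e / r.+2%:R + 13 * (e / (r.+1%:R * r.+2%:R)).
    have : 0 < (r.+1%:R : R) by rewrite ltr0n.
    rewrite -(natr1 r.+1); move: (r.+1%:R : R) => x x0.
    by field; apply/andP; split; rewrite gt_eqF//; lra.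
  rewrite lerD2l ler_pM2l// ler_wpM2l// lef_pV2 ?posrE ?exprn_gt0 ?mulr_gt0 ?ltr0n//.
  by rewrite expr2 ler_pM2r ?ltr0n// ler_nat.
have step : Ex pr (rounds F.+1 r S l) (fun o c => B * (bad (\sum_(i <- S) det i r + y) o c)%:R) <=
   Ex pr (round (M r) (eps r) i0 (Lam r) S l) (fun x _ =>
     (B * alpha r.+1 + (B - y)) + (\sum_(i <- S) excess r x.1 i + loss B r x.2)).
  rewrite [Ex pr (rounds _ _ _ _) _]Ex_bind.
  apply: (le_Ex_outs pr_ge0 (outs_round (M r) (eps0 r) (eps1 r) K_ge i0 l uS (Lam1 r))).
  move=> [w x] c /= [cw w0 xc].
  set X := \sum_(i <- S) excess r w i.
  have X0 : 0 <= X.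
    apply: sumr_ge0 => i _; rewrite /excess mulr_ge0 ?(ltW Cc0)// mulr_ge0//.
      by apply: le_trans (Lam1 r).
    by case: ifP => // _; rewrite le_max lexx.
  have cX : (c%:R : R) <= \sum_(i <- S) (if (r <= s i)%N then 3 * (Cc * T i r) else 0) + X.
    apply: le_trans cw _; rewrite /X -big_split /= !mulr_sumr.
    apply: ler_sum => i _; rewrite /excess.
    have L0 : 0 < Lam r by apply: lt_le_trans (Lam1 r).
    have -> : 13 * (K * (Lam r * w i)) = Cc * (Lam r * w i) by rewrite /Cc; ring.
    case: ifP => _; last by rewrite add0r.
    have -> : 3 * (Cc * T i r) = Cc * (Lam r * (3 * tw i r)) by rewrite /T; ring.
    rewrite -mulrDr ler_pM2l// -mulrDr ler_pM2l// -lerBlDl.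
    by rewrite le_max lexx orbT.
  have detE : \sum_(i <- S) det i r = \sum_(i <- S) (if (r <= s i)%N then 3 * (Cc * T i r) else 0) +
      \sum_(i <- S) det i r.+1.
    by rewrite -big_split /=; apply: eq_bigr => i _; exact: detS.
  case: x xc => [[S' l']|a] /=.
    move=> [S'S _]; rewrite /loss /round_loss /=.
    case: ifP => [/andP[bS' bl']|_]; last first.
      rewrite ExZ; apply: (@le_trans _ _ B).
        rewrite -[leRHS]mulr1 ler_pM2l//; apply: Ex_le => // o' c' /=.
        by rewrite lern1 leq_b1.
      have := Bal r.+1; lra.
    have uS' := subseq_uniq S'S uS.
    have bl2 : l' <= theta b <= l' + 6 * eps r.+1 by rewrite accuracyS.
    have yX : y - X <= B by lra.
    have := IH r.+1 S' l' (y - X) uS' bS' bl2 yX; rewrite -ExZ => H.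
    apply: le_trans (_ : _ <= B * alpha r.+1 + (\sum_(i <- S') kappa i r.+1 + (B - (y - X)))) _.
      apply: le_trans H; apply: le_Ex => // o' c' /=; rewrite ler_pM2l// ler_nat /bad.
      case: (if o' is Some a then a != b else false) => //=.
      case: ltP => // yc; rewrite (_ : _ < _)//; move: yc; rewrite detE natrD => yc.
      have : \sum_(i <- S') det i r.+1 <= \sum_(i <- S) det i r.+1.
        exact: ler_sum_subseq.
      lra.
    lra.
  move=> _; rewrite /loss /round_loss /bad /=; case: eqP => [_|_] /=; last first.
    by rewrite mulr1; have := Bal r.+1; lra.
  rewrite addn0; case: ltP => yc /=; last first.
    by rewrite mulr0 addr0; have := Bal r.+1; lra.
  have := det_sum0 r.+1 S; have := Bal r.+1; lra.
rewrite -ExZ; apply: le_trans step _.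
rewrite ExD Ex_cst// ExD.
have H1 := @Ex_excess r S l uS bS.
have L0 : 0 <= Lam r by apply: le_trans (Lam1 r).
have H2 := @Ex_round_loss R n (M r) (eps r) (resolution_gt0 r) (eps0 r) (eps1 r) pr pr_ge0 pr_sum
  theta (theta_close r) b (far r) B (fun i => kappa i r.+1) (ltW B0) (fun i => kappa_ge0 i r.+1)
  (fun i ib => @theta_far r i ib) theta_max (fun fb i _ => leq_trans (s_max i) fb)
  i0 (Lam r) S l L0 uS bS bl (Lam1 r).
have H3 := potential_step r uS bS.
have H4 := ler_wpM2l (ltW B0) alphaS.
move: H2 H3; rewrite -/(q r) -!/(tw _ r) /far; set P := _ + kappa b r.+1 * _ => H2 H3.
move: H1 H2 H3 H4; rewrite /loss.
set E1 := Ex pr _ (fun x _ => \sum_(i <- S) excess r x.1 i).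
set E2 := Ex pr _ (fun x _ => round_loss _ _ _ _ _ x.2).
move: E1 E2 P (\sum_(i <- S) cost i r) (\sum_(i <- S) kappa i r) (alpha r) (alpha r.+1) (q r).
move=> *; lra.
Qed.

End loop.

(** * Comparison with the gaps *)

Section gap.
Variables (R : realType) (n : nat) (theta : 'I_n -> R) (b : 'I_n).
Hypothesis n2 : (2 <= n)%N.
Hypothesis theta01 : forall i, 0 <= theta i <= 1.
Hypothesis b_best : forall j, j != b -> theta j < theta b.

Lemma gap_other i : i != b -> gap theta b i = theta b - theta i.
Proof. by rewrite /gap => /negbTE->. Qed.

Lemma gap_best_le i : gap theta b b <= gap theta b i.
Proof.
have [->//|ib] := eqVneq i b; rewrite (gap_other ib) /gap eqxx lerD2l lerN2.
exact: le_bigmax_cond.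
Qed.

Lemma gap_gt0 i : 0 < gap theta b i.
Proof.
apply: lt_le_trans (gap_best_le i); rewrite /gap eqxx subr_gt0.
apply: bigmax_lt => [|j]; last exact: b_best.
have [j jb] : exists j : 'I_n, j != b.
  case: n n2 b => [//|[//|m]] _ b'.
  have [->|] := eqVneq b' ord0; first by exists ord_max.
  by move=> b0; exists ord0; rewrite eq_sym.
by apply: le_lt_trans (b_best jb); have /andP[] := theta01 j.
Qed.

Lemma gap_le1 i : gap theta b i <= 1.
Proof.
have /andP[_ b1] := theta01 b.
rewrite /gap; case: ifP => _; rewrite lerBlDr (le_trans b1)// lerDl.
  by apply: bigmax_ge_id.
by have /andP[] := theta01 i.
Qed.

End gap.

(** * The round at which an arm becomes far *)

Section stopping_scale.
Variable R : realType.

Lemma ex_accuracy_le (x : R) : 0 < x -> exists k, 6 * accuracy R k <= x.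
Proof.
move=> x0; have bern k : 1 + k%:R / 2 <= (3 / 2) ^+ k :> R.
  elim: k => [|k IH]; first by rewrite mul0r addr0 expr0.
  have k0 : 0 <= (k%:R : R) by [].
  by rewrite exprS -natr1; lra.
exists (nsamp (2 / x)); set k := nsamp _.
have /nsampP/andP[kx _] : 0 <= 2 / x by rewrite divr_ge0// ltW.
rewrite ler_pdivrMr// -/k in kx.
have -> : 6 * accuracy R k = ((3 / 2) ^+ k)^-1.
  by rewrite /accuracy -exprVn invf_div; field.
rewrite invf_ple ?posrE ?exprn_gt0 ?divr_gt0//.
apply: le_trans (bern k); rewrite -div1r ler_pdivrMr//; lra.
Qed.

Definition stop_scale (x : R) (x0 : 0 < x) : nat := ex_minn (ex_accuracy_le x0).

Lemma accuracy_antitone r k : (r <= k)%N -> accuracy R k <= accuracy R r.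
Proof.
move=> rk; rewrite /accuracy ler_pM2r//.
by apply: ler_wiXn2l => //; lra.
Qed.

Lemma stop_scale_far (x : R) (x0 : 0 < x) r : (stop_scale x0 <= r)%N -> 6 * accuracy R r <= x.
Proof.
rewrite /stop_scale; case: ex_minnP => m mx _ mr.
by apply: le_trans mx; rewrite ler_pM2l// accuracy_antitone.
Qed.

Lemma stop_scale_le (x y : R) (x0 : 0 < x) (y0 : 0 < y) : x <= y ->
  (stop_scale y0 <= stop_scale x0)%N.
Proof.
move=> xy; rewrite /stop_scale; case: ex_minnP => m my mmin; case: ex_minnP => k kx _.
by apply: mmin; exact: le_trans kx xy.
Qed.

(** By minimality the previous round has [6 * accuracy] above [x], and 9 = 6 * 3/2. At scale 0 the
    assumption [x <= 1] is enough. *)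
Lemma stop_scale_close (x : R) (x0 : 0 < x) : x <= 1 -> x <= 9 * accuracy R (stop_scale x0).
Proof.
move=> x1; rewrite /stop_scale; case: ex_minnP => -[|m] mx mmin.
  by rewrite /accuracy expr0; lra.
have := accuracyS R m; have [//|] := leP (6 * accuracy R m) x.
  by move=> /mmin; rewrite ltnn.
lra.
Qed.

Lemma ln_stop_scale (x : R) (x0 : 0 < x) : x <= 1 ->
  ln (stop_scale x0).+2%:R <= 2 + LL x^-1.
Proof.
move=> x1; set s := stop_scale x0.
have l0 : 0 <= ln x^-1 by rewrite ln_ge0// -div1r ler_pdivlMr// mul1r.
have e2 : 2 <= expR 1 :> R by apply: le_trans (expR_ge1Dx 1); lra.
(* Take logarithms in [x <= 3 / 2 * (2 / 3) ^+ s], using [2 / 3 <= expR (- (1 / 3))] and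
   [3 / 2 <= expR (1 / 2)]. *)
have sx : s%:R <= 2 + 3 * ln x^-1.
  have : x <= 9 * accuracy R s := stop_scale_close x0 x1.
  rewrite /accuracy => xs.
  have e3 : (2 / 3 : R) ^+ s <= expR (s%:R * - (1 / 3)).
    rewrite expRM_natl lerXn2r ?nnegrE ?expR_ge0//; apply: le_trans (expR_ge1Dx _); lra.
  have e4 : (3 / 2 : R) <= expR (1 / 2) by apply: le_trans (expR_ge1Dx _); lra.
  have : x <= expR (1 / 2 + s%:R * - (1 / 3)).
    rewrite expRD; apply: (@le_trans _ _ (3 / 2 * (2 / 3) ^+ s)); first by lra.
    by apply: ler_pM => //; apply: exprn_ge0; lra.
  rewrite lnV ?posrE// => xe.
  have : ln x <= 1 / 2 + s%:R * - (1 / 3).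
    by rewrite -[leRHS]expRK ler_ln ?posrE ?expR_gt0.
  lra.
rewrite /LL; have -> : 2 + ln (expR 1 + ln x^-1) = ln (expR 2 * (expR 1 + ln x^-1)).
  by rewrite lnM ?posrE ?expR_gt0// ?expRK//; lra.
rewrite ler_ln ?posrE ?ltr0n// ?mulr_gt0 ?expR_gt0//; last by lra.
have e4 : 3 <= expR 2 :> R by apply: le_trans (expR_ge1Dx 2); lra.
rewrite -(natr1 s.+1) -(natr1 s).
have : 0 <= (expR 2 - 3) * (expR 1 + ln x^-1) by apply: mulr_ge0; lra.
lra.
Qed.

End stopping_scale.

(** * Weights of the rounded and of the true distributions *)

Section hardness.
Variables (R : realType) (n : nat) (D : 'I_n -> probability R R).
Hypothesis D01 : forall i, D i [set x : R | 0 <= x <= 1] = 1%E.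

Definition hardness (i : 'I_n) (e : R) : R := dvar (D i) / e ^+ 2 + 1 / e.

Section accuracy_resolution.
Variables (i : 'I_n) (M : nat) (e : R).
Hypotheses (M0 : (0 < M)%N) (e0 : 0 < e) (e1 : e <= 1) (Me : M%:R^-1 <= e / 4).

Let sqr_inv_le : 2 * M%:R^-1 ^+ 2 <= e.
Proof.
have M1 : 0 <= (M%:R^-1 : R) by rewrite invr_ge0.
have : (M%:R^-1 : R) * M%:R^-1 <= e / 4 * 1 by apply: ler_pM => //; have := Me; have := e1; lra.
by rewrite expr2; have := e0; lra.
Qed.

Let hardness_le (v v' : R) : v <= 2 * v' + e -> v / e ^+ 2 + 1 / e <= 2 * (v' / e ^+ 2 + 1 / e).
Proof.
move=> vv; have e2 : 0 < e ^+ 2 by rewrite exprn_gt0.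
have -> : v / e ^+ 2 + 1 / e = (v + e) / e ^+ 2 by field; rewrite gt_eqF.
have -> : 2 * (v' / e ^+ 2 + 1 / e) = (2 * v' + 2 * e) / e ^+ 2 by field; rewrite gt_eqF.
by rewrite ler_pM2r ?invr_gt0//; lra.
Qed.

Lemma weight_le_hardness : weight (qlaw D) i M e <= 2 * hardness i e.
Proof.
apply: hardness_le; have := quantized_var_le (D01 i) M0; rewrite -/(qlaw D i M _).
by have := sqr_inv_le; rewrite /qvar /qmean /qlaw; lra.
Qed.

Lemma hardness_le_weight : hardness i e <= 2 * weight (qlaw D) i M e.
Proof.
apply: hardness_le; have := var_le_quantized (D01 i) M0.
by have := sqr_inv_le; rewrite /qvar /qmean /qlaw; lra.
Qed.

End accuracy_resolution.

Lemma hardness_gt0 i e : 0 < e -> 0 < hardness i e.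
Proof.
move=> e0; rewrite /hardness ltr_wpDl ?divr_gt0// divr_ge0 ?exprn_ge0 ?(ltW e0)//.
exact: dvar_ge0.
Qed.

Lemma hardness_scale i (a e : R) : 0 < e -> 1 <= a -> hardness i e <= a ^+ 2 * hardness i (a * e).
Proof.
move=> e0 a1; have v0 := dvar_ge0 (D i); have a0 : 0 < a by lra.
have -> : a ^+ 2 * hardness i (a * e) = dvar (D i) / e ^+ 2 + a / e.
  by rewrite /hardness; field; rewrite !gt_eqF.
by rewrite lerD2l ler_pM2r ?invr_gt0.
Qed.

Lemma hardness_accuracy_up i r :
  hardness i (accuracy R r.+1) <= (9 / 4) * hardness i (accuracy R r).
Proof.
have -> : accuracy R r = 3 / 2 * accuracy R r.+1 by have := accuracyS R r; lra.
apply: le_trans (hardness_scale i (accuracy_gt0 R r.+1) (_ : 1 <= 3 / 2)) _; first by lra.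
by rewrite le_eqVlt; apply/orP; left; apply/eqP; congr (_ * _); field.
Qed.

Lemma hardness_accuracy_down i r :
  hardness i (accuracy R r) <= 2 / 3 * hardness i (accuracy R r.+1).
Proof.
have v0 := dvar_ge0 (D i); have e0 := accuracy_gt0 R r.
have -> : accuracy R r.+1 = 2 / 3 * accuracy R r by have := accuracyS R r; lra.
rewrite /hardness; set e := accuracy R r in e0 *.
have -> : 2 / 3 * (dvar (D i) / (2 / 3 * e) ^+ 2 + 1 / (2 / 3 * e)) =
    3 / 2 * (dvar (D i) / e ^+ 2) + 1 / e by field; rewrite gt_eqF.
by rewrite lerD2r ler_peMl ?divr_ge0 ?exprn_ge0 ?(ltW e0)//; lra.
Qed.

(** Hardness grows at least by 3/2 per round, so the last round dominates: 3 = 1 / (1 - 2/3). *)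
Lemma sum_hardness i m :
  \sum_(0 <= k < m.+1) hardness i (accuracy R k) <= 3 * hardness i (accuracy R m).
Proof.
elim: m => [|m IH].
  by rewrite big_nat1; have := hardness_gt0 i (accuracy_gt0 R 0); lra.
rewrite big_nat_recr//=; have := hardness_accuracy_down i m; lra.
Qed.

End hardness.

(** * Budget and success probability on one instance *)

Section instance.
Variables (R : realType) (n : nat) (c0 delta K : R).
Hypothesis n2 : (2 <= n)%N.
Hypothesis c01 : 1 <= c0.
Hypothesis delta0 : 0 < delta.
Hypothesis delta1 : delta <= 1 / 2.
Hypothesis K_ge : 1543 <= K.
Hypothesis c0_large : 181 * (13 * K) * expR (- c0) <= 1 / 2.
Variable (i0 : 'I_n).
Variable D : 'I_n -> probability R R.
Hypothesis D01 : forall i, D i [set x : R | 0 <= x <= 1] = 1%E.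
Variable b : 'I_n.
Hypothesis b_best : forall j, j != b -> dmean (D j) < dmean (D b).

Let theta i := dmean (D i).
Let Delta := gap theta b.
Let Lam := confidence c0 delta.
Let eps := accuracy R.
Let M := resolution.
Let p F : prog n (option 'I_n) := rounds i0 c0 delta F 0 (enum 'I_n) 0.

Let theta01 i : 0 <= theta i <= 1.
Proof. by rewrite dmean_ge0// dmean_le1. Qed.

Let Delta0 i : 0 < Delta i := gap_gt0 n2 theta01 b_best i.

Let Delta1 i : Delta i <= 1 := gap_le1 b theta01 i.

Let s i := stop_scale (Delta0 i).

Let eps0 r : 0 < eps r := accuracy_gt0 R r.

Let eps1 r : eps r <= 1.
Proof. by apply: le_trans (accuracy_le R r) _; lra. Qed.

Let tw i r := weight (qlaw D) i (M r) (eps r).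

Let tw_le i r : tw i r <= 2 * hardness D i (eps r).
Proof. by apply: weight_le_hardness => //; [exact: resolution_gt0|exact: resolution_accuracy]. Qed.

(** 9 = 2 * (9/4) * 2: to [hardness], one round further, and back. *)
Let tw_growth i r : tw i r.+1 <= 9 * tw i r.
Proof.
have := tw_le i r.+1; have := hardness_accuracy_up D i r.
have := hardness_le_weight D01 i (resolution_gt0 r) (eps0 r) (eps1 r) (resolution_accuracy R r).
by rewrite -/(M r) -/(eps r) -/(eps r.+1) -/(tw i r); lra.
Qed.

Let tw0 i r : 0 < tw i r.
Proof.
by apply: weight_gt0; [exact: qlaw_ge0|exact: eps0].
Qed.

Let budget := \sum_(i < n) \sum_(0 <= k < (s i).+1) Lam k * tw i k.

Let Lam1 r : 1 <= Lam r := confidence_ge1 c01 delta0 delta1 r.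

Let Lam_stop i : Lam (s i) <= (c0 + 6) * (ln delta^-1 + LL (Delta i)^-1).
Proof.
have := ln_stop_scale (Delta0 i) (Delta1 i); rewrite -/(s i) => ls.
have l0 := ln_inv_delta_ge0 delta0 delta1; have c1 := c01.
have LL1 : 1 <= LL (Delta i)^-1.
  rewrite /LL -[leLHS]expRK ler_ln ?posrE ?expR_gt0//.
    by rewrite lerDl ln_ge0// -div1r ler_pdivlMr// mul1r Delta1.
  rewrite ltr_pwDl ?expR_gt0// ln_ge0// -div1r ler_pdivlMr// mul1r.
  exact: Delta1.
rewrite /Lam /confidence.
have : 0 <= (c0 + 5) * ln delta^-1 by apply: mulr_ge0; lra.
have : 0 <= (c0 + 4) * (LL (Delta i)^-1 - 1) by apply: mulr_ge0; lra.
lra.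
Qed.

Let hardness_stop i : hardness D i (eps (s i)) <=
  81 * (dvar (D i) / Delta i ^+ 2 + 1 / Delta i).
Proof.
have D9 := stop_scale_close (Delta0 i) (Delta1 i); rewrite -/(s i) -/(eps _) in D9.
have v0 := dvar_ge0 (D i); have e0 := eps0 (s i); have d0 := Delta0 i.
have ie : 1 / eps (s i) <= 9 / Delta i by rewrite ler_pdivrMr// mulrAC ler_pdivlMr//; lra.
have ie0 : 0 <= 1 / eps (s i) by rewrite divr_ge0// ltW.
have id0 : 0 <= 1 / Delta i by rewrite divr_ge0// ltW.
have ie2 : (1 / eps (s i)) ^+ 2 <= (9 / Delta i) ^+ 2 by rewrite lerXn2r ?nnegrE//; lra.
have := ler_wpM2l v0 ie2.
have -> : (1 / eps (s i)) ^+ 2 = 1 / eps (s i) ^+ 2 by field; rewrite gt_eqF.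
have -> : (9 / Delta i) ^+ 2 = 81 * (1 / Delta i ^+ 2) by field; rewrite gt_eqF.
by rewrite /hardness; lra.
Qed.

(** 486 = 2 * 3 * 81: from weights to hardness, the geometric sum, and from [eps (s i)] to the gap.
    The confidence is replaced by its largest value, at [s i]. *)
Let budget_le : budget <= 486 * (c0 + 6) * \sum_(i < n)
  (dvar (D i) / Delta i ^+ 2 + 1 / Delta i) * (ln delta^-1 + LL (Delta i)^-1).
Proof.
rewrite mulr_sumr; apply: ler_sum => i _.
have L0 : 0 <= Lam (s i) by apply: le_trans (Lam1 _).
apply: (@le_trans _ _ (Lam (s i) * (6 * hardness D i (eps (s i))))).
  have := sum_hardness D i (s i); rewrite -(ler_pM2l (ltr0Sn R 1)).
  rewrite -/(eps _) => H; apply: (@le_trans _ _ (Lam (s i) * (2 * \sum_(0 <= k < (s i).+1) hardness D i (eps k)))).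
    rewrite mulr_sumr mulr_sumr; apply: ler_sum_nat => k /andP[_ ks].
    apply: ler_pM; rewrite ?(ltW (tw0 _ _)) ?tw_le//; first by apply: le_trans (Lam1 _).
    by apply: confidence_le; rewrite -ltnS.
  by rewrite ler_wpM2l//; lra.
have H0 : 0 <= 6 * hardness D i (eps (s i)) by rewrite mulr_ge0// ltW// hardness_gt0.
apply: le_trans (ler_pM L0 H0 (Lam_stop i) (ler_wpM2l (ler0n R 6) (hardness_stop i))) _.
by rewrite le_eqVlt; apply/orP; left; apply/eqP; ring.
Qed.

Let cost_le := (3 * (13 * K) + 1) * (486 * (c0 + 6)) * \sum_(i < n)
  (dvar (D i) / Delta i ^+ 2 + 1 / Delta i) * (ln delta^-1 + LL (Delta i)^-1).

Let budget_gt0 : 0 < budget.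
Proof.
have t i : 0 < \sum_(0 <= k < (s i).+1) Lam k * tw i k.
  rewrite big_ltn// ltr_pwDl//; first by rewrite mulr_gt0// (lt_le_trans _ (Lam1 0)).
  by apply: sumr_ge0 => k _; rewrite mulr_ge0 ?(ltW (tw0 _ _))//; apply: le_trans (Lam1 k).
rewrite /budget (bigD1 i0)//= ltr_pwDl//.
by apply: sumr_ge0 => i _; exact: ltW.
Qed.

Let e0_small : expR (- c0) * (181 * (13 * K)) <= 1 / 2.
Proof. by have := c0_large; lra. Qed.

(** [Ex_rounds] is applied with [y = B = budget]. The choice of [c0] leaves [delta / 2] for wrong
    decisions ([alpha]) and [delta / 2] for Markov's inequality on the excess ([kappa]). *)
Lemma Ex_bad_le F : Ex (qlaw D) (p F)
  (fun o c => (bad b ((3 * (13 * K) + 1) * budget) o c)%:R) <= delta.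
Proof.
have Tq := fun i k => mulr_ge0 (le_trans ler01 (Lam1 k)) (ltW (tw0 i k)).
have s_max i : (s i <= s b)%N.
  by apply: stop_scale_le; exact: gap_best_le.
have tc r i : qmean (qlaw D) i (M r) <= theta i <= qmean (qlaw D) i (M r) + eps r / 4.
  have /andP[m1 m2] := quantized_mean (D01 i) (resolution_gt0 r).
  rewrite /qmean /qlaw -/(M r) in m1 m2 *; rewrite m1 /=.
  by apply: le_trans m2 _; rewrite lerD2l; exact: resolution_accuracy.
have tf r i : i != b -> (s i <= r)%N -> theta i + 6 * eps r <= theta b.
  move=> ib /stop_scale_far; rewrite /Delta (gap_other theta ib) -/(eps r); lra.
have tm i : i != b -> theta i <= theta b by move=> /b_best/ltW.
have bl : (0 : R) <= theta b <= 0 + 6 * accuracy R 0.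
  by have /andP[-> t1] := theta01 b; rewrite /accuracy expr0; lra.
have := @Ex_rounds R n i0 c0 delta c01 delta0 delta1 K K_ge c0_large (qlaw D)
  (@qlaw_ge0 R n D) (@qlaw_sum R n D) theta b s tc tm tf s_max tw_growth budget budget_gt0
  F 0 (enum 'I_n) 0 budget (enum_uniq _) (mem_enum _ b) bl (lexx _).
rewrite subrr addr0.
have -> : \sum_(i <- enum 'I_n) (\sum_(0 <= k < (s i).+1) 3 * (13 * K * (confidence c0 delta k *
   weight (qlaw D) i (resolution k) (accuracy R k)))) + budget = (3 * (13 * K) + 1) * budget.
  have -> : (3 * (13 * K) + 1) * budget = 3 * (13 * K) * budget + budget by ring.
  congr (_ + _); rewrite big_enum /= /budget mulr_sumr.
  apply: eq_bigr => i _; rewrite mulr_sumr; apply: eq_bigr => k _.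
  by rewrite -[RHS]mulrA.
have Hk : \sum_(i <- enum 'I_n) (if (0 <= s i)%N then 181 * (13 * K * \sum_(0 <= k < (s i).+1)
   expR (- confidence c0 delta k) * (confidence c0 delta k *
   weight (qlaw D) i (resolution k) (accuracy R k))) else
   2 * (13 * K * (confidence c0 delta 0 * weight (qlaw D) i (resolution 0) (accuracy R 0)))) <=
   delta / 2 * budget.
  rewrite big_enum /= /budget mulr_sumr; apply: ler_sum => i _.
  rewrite mulr_sumr mulr_sumr mulr_sumr; apply: ler_sum => k _.
  rewrite mulrA mulrA mulrA -[leLHS]mulrA; apply: ler_wpM2r; first exact: Tq.
  rewrite expR_confidence//.
  have e1 : expR (- c0) * delta / k.+2%:R ^+ 2 <= expR (- c0) * delta.
    rewrite ler_piMr ?mulr_ge0 ?expR_ge0 ?(ltW delta0)// invf_le1 ?exprn_gt0 ?ltr0n//.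
    by rewrite -natrX ler1n expn_gt0.
  have K0 : 0 <= 181 * (13 * K) by have := K_ge; lra.
  apply: le_trans (ler_wpM2l K0 e1) _.
  have := ler_wpM2r (ltW delta0) e0_small; move: (expR (- c0)) => x; lra.
move=> H.
rewrite -(ler_pM2l budget_gt0); apply: le_trans H _.
apply: le_trans (lerD (lexx _) Hk) _.
have K1 : 1 <= K by have := K_ge; lra.
have ee : 13 * expR (- c0) <= 1 / 2.
  have := ler_wpM2r (expR_ge0 (- c0)) K1; have := e0_small; have := expR_ge0 (- c0); lra.
have ed : 13 * (expR (- c0) * delta) / 1 <= delta / 2.
  by have := ler_wpM2r (ltW delta0) ee; rewrite divr1; lra.
have := ler_wpM2l (ltW budget_gt0) ed.
move: (budget * (_ / 1)) => x; lra.
Qed.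

Lemma Ex_good_ge F : cost_le < F%:R ->
  1 - delta <= Ex (qlaw D) (p F) (fun o c => ((o == Some b) && (c%:R <= cost_le))%:R).
Proof.
move=> NF; rewrite lerBlDr; apply: le_trans (lerD (lexx _) (Ex_bad_le F)).
rewrite -ExD -{1}(Ex_cst (@qlaw_sum _ _ D) (p F) 1).
have oN := outs_rounds_none i0 c01 delta0 delta1 F 0 0 (enum_uniq 'I_n).
apply: (le_Ex_outs (@qlaw_ge0 _ _ D) oN) => o' c oc.
rewrite -natrD ler1n /bad; case: o' oc => [a|] oc /=.
  have [->|ab] := eqVneq a b; last by rewrite addn_gt0 orbT.
  rewrite eqxx /=; case: ltP => //= cN; first by rewrite addn1.
  rewrite (le_trans cN)// /cost_le -mulrA; apply: ler_wpM2l; last exact: budget_le.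
  by have := K_ge; lra.
(* No output within the fuel: at least [F] samples were drawn, more than the budget allows, so this
   branch is bad too. *)
rewrite (lt_le_trans _ (_ : F%:R <= c%:R)) ?ler_nat ?oc//.
apply: le_lt_trans NF; rewrite /cost_le -mulrA; apply: ler_wpM2l; last exact: budget_le.
by have := K_ge; lra.
Qed.

End instance.

Theorem theorem5p1 (R : realType) :
  exists C : R, 0 < C /\
  forall (n : nat), (2 <= n)%N ->
  forall delta : R, 0 < delta -> delta <= 1 / 2 ->
  exists alg : algorithm R n,
  forall (D : 'I_n -> probability R R),
    (forall i, D i [set x : R | 0 <= x <= 1] = 1%E) ->
  forall b : 'I_n,
    (forall j, j != b -> dmean (D j) < dmean (D b)) ->
  forall (d : measure_display) (Omega : measurableType d)
         (P : probability Omega R)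
         (X : 'I_n -> nat -> Omega -> R) (U : nat -> Omega -> R),
    (forall i k, measurable_fun setT (X i k)) ->
    (forall t, measurable_fun setT (U t)) ->
    (forall i k A, measurable A -> P (X i k @^-1` A) = D i A) ->
    (forall t A, measurable A -> P (U t @^-1` A) = uniform_prob (@ltr01 R) A) ->
    mutually_independent P
      (fun s : ('I_n * nat) + nat =>
         match s with inl (i, k) => X i k | inr t => U t end) ->
    let theta := fun i => dmean (D i) in
    let Delta := gap theta b in
    let bound := C * \sum_(i < n)
        (dvar (D i) / Delta i ^+ 2 + 1 / Delta i) *
        (ln delta^-1 + LL (Delta i)^-1) in
    let good := [set w | outputs_within alg (fun i k => X i k w)
                                             (fun t => U t w) b bound] in
    measurable good /\ (1 - delta%:E <= P good)%E.
Proof.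
pose K : R := 1543.
have K_ge : 1543 <= K := lexx _.
have Ke : 2 <= 2 * (181 * (13 * K)) by rewrite /K; lra.
have K4 : 4 <= 2 * (181 * (13 * K)) by rewrite /K; lra.
move: K K_ge Ke K4 => K K_ge Ke K4.
(* The solution of [181 * (13 * K) * expR (- c0) = 1 / 2]. *)
pose c0 := ln (2 * (181 * (13 * K))).
have c01 : 1 <= c0.
  rewrite -[leLHS]expRK ler_ln ?posrE ?expR_gt0//; last by lra.
  apply: le_trans K4; have e2 : expR (1 / 2) <= 2 :> R.
    by apply: le_trans (expR_le_inv _) _; [lra|rewrite -div1r ler_pdivrMr; lra].
  have -> : expR 1 = expR (1 / 2) * expR (1 / 2) :> R by rewrite -expRD; congr expR; lra.
  have e0 := expR_ge0 (1 / 2 : R).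
  by have := ler_pM e0 e0 e2 e2; lra.
have c0_large : 181 * (13 * K) * expR (- c0) <= 1 / 2.
  rewrite expRN lnK ?posrE; last by lra.
  by rewrite ler_pdivrMr; lra.
exists ((3 * (13 * K) + 1) * (486 * (c0 + 6))); split.
  by apply: mulr_gt0; lra.
move=> n n2 delta delta0 delta1.
pose i0 := Ordinal (ltnW n2).
pose p F : prog n (option 'I_n) := rounds i0 c0 delta F 0 (enum 'I_n) 0.
have p_mono F F' : (F <= F')%N -> refines (p F) (p F') by exact: refines_rounds.
have p_none F : outs (p F) (fun r c => r = None -> (F <= c)%N).
  by apply: outs_rounds_none => //; exact: enum_uniq.
exists (alg_of p i0) => D D01 b b_best d Omega P X U mX mU lawX lawU ind theta Delta bound good.
(* With fuel above the bound, giving up implies exceeding the bound, so the finite program [p F]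
   decides the event. *)
pose F := (Num.truncn bound).+1.
have NF : bound < F%:R by exact: truncnS_gt.
have goodE : good = exec_event X (p F) (fun _ => 0%N) (fun r c => (r == Some b) && (c%:R <= bound)).
  apply/seteqP; split=> w /=; rewrite /good /exec_event /=.
    by move=> /(outputs_within_exec p_mono p_none i0 _ _ _ NF).
  by move=> ?; apply/(outputs_within_exec p_mono p_none i0 _ _ _ NF).
have indX (J : seq ('I_n * nat)) (B : 'I_n * nat -> set R) :
    uniq J -> (forall s, s \in J -> measurable (B s)) ->
    P (\big[setI/setT]_(s <- J) (X s.1 s.2 @^-1` B s)) = (\prod_(s <- J) D s.1 (B s))%E.
  move=> uJ mB.
  have := ind (map inl J) (fun s => if s is inl s' then B s' else setT).
  rewrite map_inj_uniq//; last by move=> ? ? [].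
  rewrite !big_map => /(_ uJ) H; apply: etrans (etrans _ (H _)) _.
  - by congr (P _); apply: eq_bigr => -[].
  - by move=> s /mapP[s' s'J ->]; exact: mB.
  - by apply: eq_big_seq => -[i k] sJ; rewrite /= lawX//; exact: mB (i, k) sJ.
rewrite goodE; split; first exact: measurable_exec_event.
rewrite (exec_law mX indX) -EFinB lee_fin.
exact: (Ex_good_ge n2 c01 delta0 delta1 K_ge c0_large i0 D01 b_best NF).
Qed.
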